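(* Let $\mathbb K$ be a field of characteristic $p>2$, $n,r\ge1$, $\Lambda_1,\dots,\Lambda_n\in\mathbb F_p\subset\mathbb K$, $a\in\mathbb F_p^\times$, $\kappa=1$. Let $W(s,x)$ be the weight function and $F(s,x)$ the polynomial master function (see context), and consider the expansion of the $V_{\mathbb K}$-valued polynomial $$W(s,x)F(s,x)=\sum_{i_1,\dots,i_r\in\mathbb Z_{\ge0}}Q_{i_1,\dots,i_r}(x)\,h_{i_1}(s_1)\cdots h_{i_r}(s_r),$$ where $h_k(y)=y(y-a)\cdots(y-(k-1)a)$, $h_0(y)=1$. Then for any $l_1,\dots,l_r\in\mathbb Z_{\ge0}$, the $V_{\mathbb K}$-valued polynomial $Q(x)=Q_{pl_1+p-1,\dots,pl_r+p-1}(x)$ is a flat section of the qKZ connection: $$Q(x+af_m)=K_m(x)Q(x),\qquad m=1,\dots,n.$$ Furthermore, $Q$ is an eigensection of the $p$-curvature operators with all eigenvalues equal to $1$, that is, $$\tilde K_m(x)Q(x)=Q(x),\qquad m=1,\dots,n.$$ Also, $e\,Q(x)=0$.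
   Context: $\mathbb F_p$ is the prime subfield of $\mathbb K$; $s=(s_1,\dots,s_r)$, $x=(x_1,\dots,x_n)$ are variables; $x+af_m$ is $x$ with $m$-th coordinate increased by $a$. Identities are between $V_{\mathbb K}$-valued rational functions of $x$. Fiber. $\mathfrak{gl}_2$ over $\mathbb K$ has standard generators $e_{ij}$; set $e=e_{12}$, $f=e_{21}$, $h_1=e_{11}$, $h_2=e_{22}$ (not to be confused with the polynomials $h_k(y)$). $M_\Lambda$ is the Verma module with basis $f^kv_\Lambda$, $k\ge0$, where $ev_\Lambda=0$, $h_1v_\Lambda=\Lambda v_\Lambda$, $h_2v_\Lambda=0$. $V_{\mathbb K}$ is the subspace of $M_{\Lambda_1}\otimes\dots\otimes M_{\Lambda_n}$ with basis $f^{\vec r}=f^{r_1}v_{\Lambda_1}\otimes\dots\otimes f^{r_n}v_{\Lambda_n}$, $\vec r=(r_1,\dots,r_n)\in\mathbb Z_{\ge0}^n$, $r_1+\dots+r_n=r$. The generator $e$ acts on the tensor product diagonally. $R$-matrix. $R_{\Lambda_1,\Lambda_2}(x)\in\mathrm{End}(M_{\Lambda_1}\otimes M_{\Lambda_2})(x)$ is the unique operator, rational in $x$, with $R(x)(f\otimes1+1\otimes f)=(f\otimes1+1\otimes f)R(x)$, $R(x)(f\otimes h_2+(h_1-x)\otimes f)=(f\otimes h_1+(h_2-x)\otimes f)R(x)$, $R(x)\,v_{\Lambda_1}\otimes v_{\Lambda_2}=v_{\Lambda_1}\otimes v_{\Lambda_2}$ (here $R=R_{\Lambda_1,\Lambda_2}$).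 It preserves weight subspaces. $R^{(i,j)}_{\Lambda_i,\Lambda_j}$ denotes its action on the $i$-th and $j$-th tensor factors (first factor of $R$ on the $i$-th). qKZ functions on $V_{\mathbb K}$ (with $\kappa=1$): $$K_m(x)=R^{(m,m-1)}_{\Lambda_m,\Lambda_{m-1}}(x_m-x_{m-1}+a)\cdots R^{(m,1)}_{\Lambda_m,\Lambda_1}(x_m-x_1+a)\,R^{(m,n)}_{\Lambda_m,\Lambda_n}(x_m-x_n)\cdots R^{(m,m+1)}_{\Lambda_m,\Lambda_{m+1}}(x_m-x_{m+1}),$$ and $\tilde K_m(x)=K_m(x+(p-1)af_m)\cdots K_m(x+af_m)K_m(x)$. Weight function: $W(s,x)=\sum_{\vec r}W_{\vec r}(s,x)f^{\vec r}$, where $$W_{\vec r}=\frac1{r_1!\cdots r_n!}\sum_{\sigma\in S_r}\Bigl[\prod_{i=1}^n\ \prod_{j=r_1+\dots+r_{i-1}+1}^{r_1+\dots+r_i}\Bigl(\prod_{i'<i}(s_j-x_{i'}+\Lambda_{i'})\prod_{i''>i}(s_j-x_{i''})\Bigr)\prod_{1\le j'<j''\le r}\frac{s_{j'}-s_{j''}+1}{s_{j'}-s_{j''}}\Bigr]_{s_j\mapsto s_{\sigma(j)}};$$ computed over $\mathbb Q$ with $\Lambda_i$ as variables this is a polynomial in $s,x,\Lambda$ with integer coefficients, which is then reduced modulo $p$. Master function: for $b\in\mathbb F_p$ let $\bar b\in\{1,\dots,p\}$ be such that $a\bar b=b$ in $\mathbb F_p$, and set $g(y,b)=h_{\bar b-1}(y+b-a)=(y+b-a)\cdots(y+2a)(y+a)$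 (a product of $\bar b-1$ factors). Then $$F(s,x)=\prod_{m=1}^n\prod_{l=1}^r g(s_l-x_m,\Lambda_m)\cdot\prod_{1\le j<l\le r}\bigl((s_l-s_j)\,g(s_l-s_j+1,-2)\bigr).$$ *)

(* Defs.v *)
From HB Require Import structures.
From mathcomp Require Import all_boot all_order all_algebra perm.
From mathcomp Require Import generic_quotient ring.
From mathcomp Require Export fraction.
From mathcomp.multinomials Require Export freeg mpoly.

Set Implicit Arguments.
Unset Strict Implicit.
Unset Printing Implicit Defensive.

Import GRing.Theory.

Local Open Scope ring_scope.

(* The inclusion of 'F_p in a ring of characteristic p. *)
Definition of_Fp (p : nat) (B : pzRingType) (z : 'F_p) : B := (nat_of_ord z)%:R.
Arguments of_Fp {p} B z.

(* M_{Lam_1} (x) ... (x) M_{Lam_n} over the coefficient ring B.  The basis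
   vector f^(m_1) v_1 (x) ... (x) f^(m_n) v_n is << m >> with
   m : 'X_{1..n} a vector of n natural numbers. *)
Definition tens (B : nzRingType) (n : nat) := {freeg 'X_{1..n} / B}.

Section Action.
Variables (B : nzRingType) (n : nat) (Lam : 'I_n -> B).

(* The generators of gl_2 acting on the i-th tensor factor.  From
   [e, f] = h1 - h2, e v = 0, h1 v = Lam v and h2 v = 0:
     e f^k v = k (Lam - k + 1) f^(k-1) v,
     h1 f^k v = (Lam - k) f^k v,   h2 f^k v = k f^k v. *)
Definition f_at (i : 'I_n) : tens B n -> tens B n :=
  fglift (fun m : 'X_{1..n} => << (m + U_(i))%MM >> : tens B n).

Definition e_at (i : 'I_n) : tens B n -> tens B n :=
  fglift (fun m : 'X_{1..n} =>
    << (m i)%:R * (Lam i - (m i)%:R + 1) *g (m - U_(i))%MM >> : tens B n).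

Definition h1_at (i : 'I_n) : tens B n -> tens B n :=
  fglift (fun m : 'X_{1..n} => << Lam i - (m i)%:R *g m >> : tens B n).

Definition h2_at (i : 'I_n) : tens B n -> tens B n :=
  fglift (fun m : 'X_{1..n} => << (m i)%:R *g m >> : tens B n).

Definition e_diag (v : tens B n) : tens B n := \sum_(i < n) e_at i v.

Lemma f_atU i c m : f_at i << c *g m >> = << c *g (m + U_(i))%MM >>.
Proof.
rewrite /f_at liftU; apply/eqP/freeg_eqP => k.
by rewrite coeffZ !coeffU mul1r.
Qed.

Lemma e_atU i c m : e_at i << c *g m >> =
  << c * ((m i)%:R * (Lam i - (m i)%:R + 1)) *g (m - U_(i))%MM >>.
Proof.
rewrite /e_at liftU; apply/eqP/freeg_eqP => k.
by rewrite coeffZ !coeffU mulrA.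
Qed.

Lemma h1_atU i c m : h1_at i << c *g m >> = << c * (Lam i - (m i)%:R) *g m >>.
Proof.
rewrite /h1_at liftU; apply/eqP/freeg_eqP => k.
by rewrite coeffZ !coeffU mulrA.
Qed.

Lemma h2_atU i c m : h2_at i << c *g m >> = << c * (m i)%:R *g m >>.
Proof.
rewrite /h2_at liftU; apply/eqP/freeg_eqP => k.
by rewrite coeffZ !coeffU mulrA.
Qed.

End Action.

Lemma ef_comm (B : comNzRingType) (n : nat) (Lam : 'I_n -> B) (i : 'I_n)
    (m : 'X_{1..n}) :
  e_at Lam i (f_at i << m >>) - f_at i (e_at Lam i << m >>) =
  h1_at Lam i << m >> - h2_at i << m >>.
Proof.
rewrite f_atU !e_atU f_atU h1_atU h2_atU addmK !mnmE eqxx addn1 !mul1r.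
have [mi0|mi0] := eqVneq (m i) 0%N.
  by rewrite mi0 !freegUB !mul0r freegU0 !subr0 mul1r addrNK.
rewrite submK; last by rewrite lep1mP.
by rewrite !freegUB -natr1; congr << _ *g _ >>; ring.
Qed.

(* The defining relations of the rational R-matrix R_{lam,mu}(x), an operator
   on M_lam (x) M_mu over the field K(x). *)
Section RMatrix.
Variables (K : fieldType) (lam mu : K).
Local Notation Kx := {fraction {poly K}}.
Variable R : {linear tens Kx 2 -> tens Kx 2}.

Let x : Kx := FracField.tofrac 'X.
Let wt (i : 'I_2) : Kx :=
  FracField.tofrac (if i == ord0 then lam else mu)%:P.
Let f1 := @f_at Kx 2 ord0.
Let f2 := @f_at Kx 2 ord_max.
Let h1 := @h1_at Kx 2 wt.
Let h2 := @h2_at Kx 2.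

Definition is_Rmatrix : Prop :=
  [/\ forall v, R (f1 v + f2 v) = f1 (R v) + f2 (R v),
      forall v,
        R (f1 (h2 ord_max v) + (h1 ord0 (f2 v) - x *: f2 v)) =
        f1 (h1 ord_max (R v)) + (h2 ord0 (f2 (R v)) - x *: f2 (R v))
    & R << 0%MM >> = << 0%MM >> ].

End RMatrix.

(* Value at y of a rational function over K, where y lies in an extension L
   of K.  It does not depend on the representing ratio when y is
   transcendental over K, which is the case wherever it is used below. *)
Definition ratfun_eval (K L : fieldType) (iota : K -> L)
    (g : {fraction {poly K}}) (y : L) : L :=
  (map_poly iota \n_(repr g)).[y] / (map_poly iota \d_(repr g)).[y].

Lemma ratfun_evalE (K L : fieldType) (iota : {rmorphism K -> L}) (y : L)
    (P D : {poly K}) :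
  (forall q : {poly K}, q != 0 -> (map_poly iota q).[y] != 0) -> D != 0 ->
  ratfun_eval iota (FracField.tofrac P / FracField.tofrac D) y =
    (map_poly iota P).[y] / (map_poly iota D).[y].
Proof.
move=> tr D0; set g := _ / _.
have d0 := denom_ratioP (repr g).
have gE : FracField.tofrac \n_(repr g) =
          g * FracField.tofrac \d_(repr g).
  move: (repr g) d0 (reprK g) => f f0 <-; rewrite !piE.
  apply/eqmodP; rewrite /= FracField.equivfE /FracField.mulf.
  by rewrite !numden_Ratio ?mulr1 ?mul1r ?oner_eq0 // mulrC.
have /eqP : FracField.tofrac (\n_(repr g) * D) =
            FracField.tofrac (P * \d_(repr g)).
  by rewrite !tofracM gE /g mulrAC divfK // tofrac_eq0.
rewrite tofrac_eq => /eqP/(congr1 (fun q => (map_poly iota q).[y])).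
rewrite !rmorphM !hornerM => E.
by apply/eqP; rewrite /ratfun_eval eqr_div ?tr // E.
Qed.

Definition tens_map (B C : nzRingType) (n : nat) (phi : B -> C)
    (v : tens B n) : tens C n :=
  \sum_(m <- dom v) << phi (coeff m v) *g m >>.

Section QKZ.
Variables (K : fieldType) (n : nat).
Local Notation L := {fraction {mpoly K[n]}}.

Definition cst (c : K) : L := FracField.tofrac c%:MP.

Definition gen_pt (i : 'I_n) : L := FracField.tofrac 'X_i.

Definition shift_pt (m : 'I_n) (c : L) (z : 'I_n -> L) : 'I_n -> L :=
  fun i => if i == m then z i + c else z i.

(* Value at the point z of a vector with polynomial coordinates. *)
Definition tens_eval (v : tens {mpoly K[n]} n) (z : 'I_n -> L) : tens L n :=
  tens_map (mmap cst z) v.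

Definition pair_idx (k l : nat) : 'X_{1..2} :=
  [multinom (if t == ord0 then k else l) | t < 2].

Definition set_idx (i j : 'I_n) (u : 'X_{1..n}) (w : 'X_{1..2}) : 'X_{1..n} :=
  [multinom (if t == i then w ord0 else if t == j then w ord_max else u t)
  | t < n].

Section Operators.
Variable R : 'I_n -> 'I_n ->
  {linear tens {fraction {poly K}} 2 -> tens {fraction {poly K}} 2}.

(* R^{(i,j)}(y), for i != j. *)
Definition R_at (i j : 'I_n) (y : L) : tens L n -> tens L n :=
  fglift (fun u : 'X_{1..n} =>
    let v := R i j << pair_idx (u i) (u j) >> in
    \sum_(w <- dom v)
      << ratfun_eval cst (coeff w v) y *g set_idx i j u w >> : tens L n).

(* K_m at the point z.  The list enumerates the factors from right to left,
   i.e. in the order in which they act: m+1, ..., n, 1, ..., m-1. *)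
Definition qKZ (a : L) (m : 'I_n) (z : 'I_n -> L) (v : tens L n) : tens L n :=
  foldl (fun u j => R_at m j (z m - z j + (if (j < m)%N then a else 0)) u) v
    ([seq j : 'I_n <- enum 'I_n | (m < j)%N] ++
     [seq j : 'I_n <- enum 'I_n | (j < m)%N]).

(* K_m(z + (p-1) a f_m) ... K_m(z + a f_m) K_m(z) *)
Definition pcurv (p : nat) (a : L) (m : 'I_n) (z : 'I_n -> L) (v : tens L n) :
    tens L n :=
  foldl (fun u k => qKZ a m (shift_pt m (k%:R * a) z) u) v (iota 0 p).

End Operators.
End QKZ.

Section Weight.
Variables (n r : nat).

Definition psum (u : 'X_{1..n}) (i : 'I_n) : nat :=
  (\sum_(k < n | (k < i)%N) u k)%N.

(* The coordinate W_u.  Indices j are counted from 0, so the i-th block is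
   psum u i <= j < psum u i + u i. *)
Definition weight_coord (E : fieldType) (s : 'I_r -> E) (x lam : 'I_n -> E)
    (u : 'X_{1..n}) : E :=
  (\prod_(i < n) ((u i)`!)%:R)^-1 *
  \sum_(sg : 'S_r)
    ((\prod_(i < n) \prod_(j < r | (psum u i <= j < psum u i + u i)%N)
        ((\prod_(k < n | (k < i)%N) (s (sg j) - x k + lam k)) *
         (\prod_(k < n | (i < k)%N) (s (sg j) - x k)))) *
     \prod_(j < r) \prod_(k < r | (j < k)%N)
        ((s (sg j) - s (sg k) + 1) / (s (sg j) - s (sg k)))).

(* Integer polynomials in s_1..s_r, x_1..x_n, Lam_1..Lam_n. *)
Definition svar (j : 'I_r) : 'I_(r + n + n) := lshift n (lshift n j).
Definition xvar (i : 'I_n) : 'I_(r + n + n) := lshift n (rshift r i).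
Definition lvar (i : 'I_n) : 'I_(r + n + n) := rshift (r + n) i.

(* W u is the coordinate W_u, as a polynomial with integer coefficients; it
   is determined by the equality in Q(s, x, Lam). *)
Definition is_weight (W : 'X_{1..n} -> {mpoly int[r + n + n]}) : Prop :=
  let X k : {fraction {mpoly int[r + n + n]}} := FracField.tofrac 'X_k in
  forall u : 'X_{1..n}, mdeg u = r ->
    FracField.tofrac (W u) =
      weight_coord (fun j => X (svar j)) (fun i => X (xvar i))
        (fun i => X (lvar i)) u.

Definition int_eval (B : comNzRingType) (s : 'I_r -> B) (x lam : 'I_n -> B)
    (P : {mpoly int[r + n + n]}) : B :=
  mmap intr (fun k => match split k with
                      | inl k' => match split k' with
                                  | inl j => s j
                                  | inr i => x i
                                  end
                      | inr i => lam i
                      end) P.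

End Weight.

Section Master.
Variables (p : nat) (a : 'F_p) (B : comNzRingType).

Definition hpoly (k : nat) (y : B) : B :=
  \prod_(i < k) (y - i%:R * of_Fp B a).

(* The representative in 1..p of b / a. *)
Definition fbar (b : 'F_p) : nat :=
  let k := nat_of_ord (b / a) in if k == 0%N then p else k.

Definition gpoly (y : B) (b : 'F_p) : B :=
  hpoly (fbar b).-1 (y + of_Fp B b - of_Fp B a).

Definition master (n r : nat) (Lam : 'I_n -> 'F_p) (s : 'I_r -> B)
    (x : 'I_n -> B) : B :=
  (\prod_(m < n) \prod_(l < r) gpoly (s l - x m) (Lam m)) *
  \prod_(j < r) \prod_(l < r | (j < l)%N)
     ((s l - s j) * gpoly (s l - s j + 1) (- 2%:R)).

End Master.
Arguments hpoly {p} a {B} k y.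

Lemma fbarP (p : nat) (a b : 'F_p) : prime p -> a != 0 ->
  (0 < fbar a b <= p)%N /\ a * (fbar a b)%:R = b.
Proof.
move=> pr_p a0; rewrite /fbar; case: eqVneq => [k0|k0].
  rewrite prime_gt0 // leqnn; split=> //.
  have /eqP: b / a = 0 by apply/val_inj.
  by rewrite mulf_eq0 invr_eq0 (negPf a0) orbF => /eqP ->; rewrite pchar_Fp_0 // mulr0.
split; first by rewrite lt0n k0 ltnW // -[X in (_ < X)%N](Fp_cast pr_p) ltn_ord.
by rewrite natr_Zp mulrC divfK.
Qed.

Section Expansion.
Variables (K : fieldType) (p n r : nat) (a : 'F_p) (Lam : 'I_n -> 'F_p).
Variable W : 'X_{1..n} -> {mpoly int[r + n + n]}.
Local Notation A := {mpoly K[n]}.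
Local Notation B := {mpoly A[r]}.

(* B is K[x][s]. *)
Let s (j : 'I_r) : B := 'X_j.
Let x (i : 'I_n) : B := ('X_i : A)%:MP.

Definition weight_master : tens B n :=
  \sum_(u : 'X_{1..n < r.+1} | mdeg u == r)
    << int_eval s x (fun i => of_Fp B (Lam i)) (W u) * master a Lam s x *g
       bmnm u >>.

Definition is_expansion (Q : 'X_{1..r} -> tens A n) : Prop :=
  exists2 D : nat, forall k : 'X_{1..r}, (D <= mdeg k)%N -> Q k = 0 &
    weight_master =
      \sum_(k : 'X_{1..r < D})
        (\prod_(l < r) hpoly a (k l) (s l)) *:
          tens_map (@mpolyC r A) (Q (bmnm k)).

End Expansion.

(* Main.v *)
(* Writing the weight function as a sum over colourings c of the variables s_j
   by the tensor factors, multiplication by prod_(j < k) (s_k - s_j), which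
   divides the master function F, clears all denominators.  Hence W F is a sum
   of polynomials N_c F', one for each colouring, and this makes sense for any
   order of the tensor factors.  Two facts give the flatness:
   - R^(m,j)(x_m - x_j) takes the weight function of an order in which m comes
     immediately before j to that of the order with m and j exchanged;
   - shifting by - a the variables of colour m takes the term N_c F' for the
     order in which m is last to the term for the order in which m is first,
     at the point x + a f_m.
   The coefficient at prod_j h_(p l_j + p - 1)(s_j) does not see the second
   shift, because h_k(y + a) - h_k(y) = k a h_(k-1)(y) vanishes for k = p l_j + p.
   So on the coefficient Q the factors of K_m move m to the last place, then,
   after the cyclic step, from the first place back to its own.
   The vector e W F is treated in the same way: it is a sum of differences
   between terms in which one marked variable comes last or first.  *)

Require Import Defs.
From HB Require Import structures.
From mathcomp Require Import all_boot all_order all_algebra perm.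
From mathcomp Require Import fraction ring.
From mathcomp.multinomials Require Import freeg mpoly.

Set Implicit Arguments.
Unset Strict Implicit.
Unset Printing Implicit Defensive.

Import GRing.Theory.

Local Open Scope ring_scope.

(** The R-matrix is given by its defining relations and not by a formula. This suffices because the
    two-factor weight function obeys a recursion in the number of variables, one step of which
    combines exactly the two operators that R intertwines. Characteristic p enters in two opposite
    ways. It forbids dividing by r_1!...r_n!, so the symmetrization is rewritten in characteristic
    zero as a sum over colourings, where the factorials have cancelled, and only then reduced. On
    the other hand it makes the cyclic step possible: g(y,b) is a polynomial solution of (y+a)
    g(y+a) = (y+b) g(y), the equation of the quotient of Gamma((y+b)/a) by Gamma((y+a)/a), and it
    exists because b is a positive integer multiple of a in F_p. For b = -2 this equation trades
    s_k-s_j+1 for s_k-s_j-1, that is, it reverses the order of two colours. The exchange identities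
    have coefficients free of s, so they survive any functional linear over the rational functions
    of x, such as the coefficient that defines Q. The p-curvature statement is flatness at the p
    points x + c a f_m, since p a = 0. *)

Lemma set_ind (I : finType) (P : {set I} -> Prop) :
  P set0 -> (forall (x : I) (A : {set I}), x \notin A -> P A -> P (x |: A)) ->
  forall A, P A.
Proof.
move=> P0 PU A; have [m] := ubnP #|A|; elim: m A => // m IHm A.
have [-> //|[x Ax] ltAm] := set_0Vmem A.
rewrite -(setD1K Ax); apply: PU; first by rewrite setD11.
by apply: IHm; rewrite (cardsD1 x) Ax in ltAm.
Qed.

(** * Partial fractions and the two-factor weight function *)

Section PartialFractions.
Variables (E : fieldType) (I : finType) (s : I -> E) (e : E).
Hypothesis inj_s : injective s.

(** [e * pfcoef X k] is the residue at [t = s k] of the product of the factors [1 + e / (t - s l)],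
    [l] in [X]. *)
Definition pfcoef (X : {set I}) k := \prod_(l in X | l != k) (1 + e / (s k - s l)).

Lemma pfcoefU (X : {set I}) m k : m \notin X -> k \in X ->
  pfcoef (m |: X) k = (1 + e / (s k - s m)) * pfcoef X k.
Proof.
move=> mX kX; rewrite /pfcoef (bigD1 m) /=; last first.
  by rewrite setU11; apply: contraNneq mX => ->.
congr (_ * _); apply: eq_bigl => l; rewrite !inE.
by case: (eqVneq l m) => [->|] /=; rewrite ?andbT ?andbF // (negPf mX).
Qed.

Lemma pfcoefU1 (X : {set I}) m : m \notin X ->
  pfcoef (m |: X) m = \prod_(k in X) (1 + e / (s m - s k)).
Proof.
move=> mX; apply: eq_bigl => l; rewrite !inE.
by case: (eqVneq l m) => [->|] /=; rewrite ?andbT ?andbF // (negPf mX).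
Qed.

Lemma subr_inj_neq0 k m : k != m -> s k - s m != 0.
Proof. by move=> km; rewrite subr_eq0 (inj_eq inj_s). Qed.

Lemma partial_fractions (X : {set I}) t : (forall k, k \in X -> t - s k != 0) ->
  \prod_(k in X) (1 + e / (t - s k)) =
  1 + \sum_(k in X) e * pfcoef X k / (t - s k).
Proof.
elim/set_ind: X t => [|m X mX IH] t tX; first by rewrite !big_set0 addr0.
rewrite !big_setU1 //= pfcoefU1 // !IH; last 2 first.
- by move=> k kX; apply: subr_inj_neq0; apply: contraNneq mX => ->.
- by move=> k kX; apply: tX; rewrite setU1r.
have tm : t - s m != 0 by apply: tX; rewrite setU11.
(* Each product of two simple poles is split. The parts at [s m] reassemble, by the induction
   hypothesis at [t = s m], to the residue there. *)
have key : (1 + e / (t - s m)) * (\sum_(k in X) e * pfcoef X k / (t - s k)) =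
    e / (t - s m) * (\sum_(k in X) e * pfcoef X k / (s m - s k)) +
    \sum_(k in X) e * pfcoef (m |: X) k / (t - s k).
  rewrite !mulr_sumr -big_split /=; apply: eq_bigr => k kX.
  have km : k != m by apply: contraNneq mX => <-.
  have mk : s m - s k != 0 by apply: subr_inj_neq0; rewrite eq_sym.
  have tk : t - s k != 0 by apply: tX; rewrite setU1r.
  rewrite pfcoefU //; field.
  by rewrite tk tm mk subr_inj_neq0.
by rewrite mulrDr key; ring.
Qed.

(** This compares the coefficients of [e / t] in [partial_fractions] at t = infinity, and
    [sum_mul_pfcoef] those of [e / t^2]. Induction on [X] takes the place of power series. *)
Lemma sum_pfcoef (X : {set I}) : \sum_(k in X) pfcoef X k = #|X|%:R.
Proof.
elim/set_ind: X => [|m X mX IH]; first by rewrite big_set0 cards0.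
rewrite big_setU1 //= pfcoefU1 // partial_fractions; last first.
  by move=> k kX; apply: subr_inj_neq0; apply: contraNneq mX => ->.
rewrite cardsU1 mX add1n -natr1 -IH (eq_bigr _ (fun k => pfcoefU mX)).
have key : \sum_(k in X) (1 + e / (s k - s m)) * pfcoef X k =
    \sum_(k in X) pfcoef X k - \sum_(k in X) e * pfcoef X k / (s m - s k).
  rewrite -sumrB; apply: eq_bigr => k kX.
  have km : k != m by apply: contraNneq mX => <-.
  have mk : s m - s k != 0 by apply: subr_inj_neq0; rewrite eq_sym.
  by field; rewrite mk subr_inj_neq0.
by rewrite key; ring.
Qed.

Lemma sum_mul_pfcoef (X : {set I}) :
  \sum_(k in X) s k * pfcoef X k = \sum_(k in X) s k + e * 'C(#|X|, 2)%:R.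
Proof.
elim/set_ind: X => [|m X mX IH]; first by rewrite !big_set0 cards0 mulr0 addr0.
rewrite !big_setU1 //= pfcoefU1 // partial_fractions; last first.
  by move=> k kX; apply: subr_inj_neq0; apply: contraNneq mX => ->.
rewrite cardsU1 mX add1n binS bin1 natrD.
have key : \sum_(k in X) s k * pfcoef (m |: X) k =
    \sum_(k in X) s k * pfcoef X k + e * \sum_(k in X) pfcoef X k -
    s m * \sum_(k in X) e * pfcoef X k / (s m - s k).
  rewrite !mulr_sumr -big_split -sumrB /=; apply: eq_bigr => k kX.
  have km : k != m by apply: contraNneq mX => <-.
  have mk : s m - s k != 0 by apply: subr_inj_neq0; rewrite eq_sym.
  by rewrite pfcoefU //; field; rewrite mk subr_inj_neq0.
by rewrite key IH sum_pfcoef; ring.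
Qed.

End PartialFractions.

Section TwoColours.
Variables (E : fieldType) (I : finType) (s : I -> E).
Hypothesis inj_s : injective s.

(* For al = x_2 and be = x_1 - Lam_1, this is the term of the weight function
   of two factors in which the variables of S go to the first factor. *)
Definition two_colour (al be : E) (T S : {set I}) : E :=
  (\prod_(j in S) (s j - al)) * (\prod_(k in T :\: S) (s k - be)) *
  \prod_(j in S) \prod_(k in T :\: S) (1 + 1 / (s j - s k)).

Lemma sum_subsetU (V : nmodType) (T : {set I}) t (F : {set I} -> V) :
  t \notin T ->
  \sum_(S : {set I} | S \subset t |: T) F S =
  \sum_(S : {set I} | S \subset T) (F (t |: S) + F S).
Proof.
move=> tT; rewrite big_split /= (bigID (fun S : {set I} => t \in S)) /=.
congr (_ + _).
  rewrite (reindex_onto (fun S => t |: S) (fun S => S :\ t)) /=; last first.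
    by move=> S /andP[_ tS]; rewrite setD1K.
  apply: eq_bigl => S; rewrite setU11 andbT subUset sub1set setU11 /=.
  apply/andP/idP => [[sST /eqP <-]|sST].
    by rewrite subDset subUset sub1set setU11.
  split; first by apply: subset_trans (subsetUr _ _).
  by rewrite setU1K //; apply: contra tT => /(subsetP sST).
apply: eq_bigl => S; apply/andP/idP => [[sST tS]|sST].
  by apply/subsetP => x xS; have := subsetP sST x xS; rewrite !inE;
    case: eqP => // xt; rewrite xt (negPf tS) in xS.
split; first by apply: subset_trans (subsetUr _ _).
by apply: contra tT => /(subsetP sST).
Qed.

Lemma two_colourU1 al be (T S : {set I}) t : t \notin T -> S \subset T ->
  two_colour al be (t |: T) (t |: S) =
  (s t - al) * (\prod_(k in T :\: S) (1 + 1 / (s t - s k))) *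
  two_colour al be T S.
Proof.
move=> tT sST; have tS : t \notin S by apply: contra tT => /(subsetP sST).
rewrite /two_colour.
have -> : (t |: T) :\: (t |: S) = T :\: S.
  apply/setP => k; rewrite !inE negb_or; case: eqVneq => //= ->.
  by rewrite (negPf tT) andbF.
by rewrite !big_setU1 //=; ring.
Qed.

Lemma two_colourU be al (T S : {set I}) t : t \notin T -> S \subset T ->
  two_colour al be (t |: T) S =
  (s t - be) * (\prod_(k in S) (1 + (-1) / (s t - s k))) *
  two_colour al be T S.
Proof.
move=> tT sST; have tS : t \notin S by apply: contra tT => /(subsetP sST).
rewrite /two_colour.
have -> : (t |: T) :\: S = t |: (T :\: S).
  by rewrite setDUl (setDidPl _) // disjoints1.
have tTS : t \notin T :\: S by rewrite inE negb_and tT orbT.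
rewrite big_setU1 //= [X in _ * X = _](_ : _ =
  (\prod_(k in S) (1 + (-1) / (s t - s k))) *
  \prod_(j in S) \prod_(k in T :\: S) (1 + 1 / (s j - s k))); last first.
  rewrite -big_split; apply: eq_bigr => j jS; rewrite big_setU1 //=.
  congr (_ * _); congr (1 + _).
  by rewrite -(opprB (s j)) invrN mulrNN.
by ring.
Qed.

(* Adding a variable: the residues at s t = s l of the two kinds of terms
   cancel, so only the polynomial parts in s t survive. *)
Lemma two_colour_rec al be (T : {set I}) t (G : nat -> nat -> E) :
  t \notin T ->
  \sum_(S : {set I} | S \subset t |: T)
     two_colour al be (t |: T) S * G #|S| #|(t |: T) :\: S| =
  \sum_(S : {set I} | S \subset T) two_colour al be T S *
     ((s t - al + #|T :\: S|%:R) * G #|S|.+1 #|T :\: S| +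
      (s t - be - #|S|%:R) * G #|S| #|T :\: S|.+1).
Proof.
move=> tT; rewrite sum_subsetU //.
have tk k : k \in T -> s t - s k != 0.
  by move=> kT; apply: subr_inj_neq0 => //; apply: contraNneq tT => ->.
pose rest1 (S : {set I}) :=
  \sum_(l in T :\: S) (s l - al) * pfcoef s 1 (T :\: S) l / (s t - s l).
pose rest2 (S : {set I}) := \sum_(l in S) (s l - be) * pfcoef s (-1) S l / (s t - s l).
(* Writing [s t - ga] as [(s t - s l) + (s l - ga)] at each pole separates a polynomial part, whose
   constant comes from [sum_pfcoef], from the polar parts [rest1] and [rest2]. *)
have PF e ga (X : {set I}) : X \subset T ->
    (s t - ga) * \prod_(k in X) (1 + e / (s t - s k)) =
    s t - ga + e * #|X|%:R +
    e * \sum_(l in X) (s l - ga) * pfcoef s e X l / (s t - s l).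
  move=> sXT; have tX k : k \in X -> s t - s k != 0 by move/(subsetP sXT)/tk.
  rewrite partial_fractions // -(sum_pfcoef e inj_s) mulrDr mulr1.
  rewrite -[RHS]addrA; congr (_ + _); rewrite !mulr_sumr -big_split /=.
  by apply: eq_bigr => k /tX ?; field.
have cU (S : {set I}) : S \subset T -> (#|t |: S| = #|S|.+1)%N.
  by move=> sST; rewrite cardsU1 (contra (subsetP sST t) tT).
have cD1 (S : {set I}) : S \subset T -> #|(t |: T) :\: (t |: S)| = #|T :\: S|.
  move=> sST; rewrite cardsDS ?setUS // !cU // subSS cardsDS //.
have cD2 (S : {set I}) : S \subset T -> #|(t |: T) :\: S| = #|T :\: S|.+1.
  move=> sST; rewrite cardsDS ?(subset_trans sST (subsetUr _ _)) //.
  by rewrite cU // cardsDS // subSn // subset_leq_card.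
transitivity (\sum_(S : {set I} | S \subset T) (two_colour al be T S *
     ((s t - al + #|T :\: S|%:R) * G #|S|.+1 #|T :\: S| +
      (s t - be - #|S|%:R) * G #|S| #|T :\: S|.+1) +
     (two_colour al be T S * rest1 S * G #|S|.+1 #|T :\: S| -
      two_colour al be T S * rest2 S * G #|S| #|T :\: S|.+1))).
  apply: eq_bigr => S sST.
  rewrite two_colourU1 // two_colourU // cU // cD1 // cD2 //.
  rewrite PF ?subsetDl // PF // mul1r -/(rest1 S) -/(rest2 S); ring.
rewrite big_split /= [X in _ + X](_ : _ = 0) ?addr0 // sumrB.
apply/eqP; rewrite subr_eq0; apply/eqP.
(* At the pole [s t = s l], the term with [t] in the subset and [l] outside meets the term with [l]
   inside and [t] outside. The two residues are opposite, and the cardinals agree, hence so do the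
   values of [G]. *)
transitivity (\sum_(l in T) \sum_(S : {set I} | S \subset T :\ l)
   two_colour al be T S * ((s l - al) * pfcoef s 1 (T :\: S) l / (s t - s l)) *
   G #|S|.+1 #|T :\: S|).
  rewrite (exchange_big_dep (fun S : {set I} => S \subset T)) /=; last first.
    by move=> l S _ sS; apply: subset_trans sS (subsetDl _ _).
  apply: eq_bigr => S sST; rewrite mulr_sumr mulr_suml.
  by apply: eq_big => // l; rewrite inE subsetD1 sST /= andbC.
transitivity (\sum_(l in T) \sum_(S : {set I} | (S \subset T) && (l \in S))
   two_colour al be T S * ((s l - be) * pfcoef s (-1) S l / (s t - s l)) *
   G #|S| #|T :\: S|.+1); last first.
  rewrite (exchange_big_dep (fun S : {set I} => S \subset T)) /=; last first.
    by move=> l S _ /andP[].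
  apply: eq_bigr => S sST; rewrite mulr_sumr mulr_suml.
  apply: eq_bigl => l; rewrite sST /=; apply/andP/idP => [[]//|lS].
  by rewrite (subsetP sST).
apply: eq_bigr => l lT.
rewrite [RHS](reindex_onto (fun S => l |: S) (fun S => S :\ l)) /=; last first.
  by move=> S /andP[_ lS]; rewrite setD1K.
apply: eq_big => S.
  rewrite subsetD1 subUset sub1set lT setU11 andbT /=; congr (_ && _).
  apply/idP/eqP => [lS|<-]; first by rewrite setU1K.
  by rewrite setD11.
rewrite subsetD1 => /andP[sST lS].
have TS : T :\: S = l |: (T :\: (l |: S)).
  apply/setP => k; rewrite !inE; case: eqVneq => // ->; by rewrite lS lT.
have lTS : l \notin T :\: (l |: S) by rewrite !inE eqxx.
rewrite cardsU1 lS TS cardsU1 lTS; congr (_ * _).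
have lT' : l \notin T :\ l by rewrite setD11.
rewrite -{1 3}(setD1K lT) two_colourU1 ?subsetD1 ?sST // two_colourU ?subsetD1 ?sST //.
have -> : pfcoef s 1 (l |: (T :\: (l |: S))) l =
    \prod_(k in (T :\ l) :\: S) (1 + 1 / (s l - s k)).
  rewrite pfcoefU1 //; apply: eq_bigl => k; rewrite !inE negb_or -andbA.
  by rewrite andbCA.
rewrite pfcoefU1 //; ring.
Qed.

Lemma two_colour0 al be : two_colour al be set0 set0 = 1.
Proof. by rewrite /two_colour set0D !big_set0 !mul1r. Qed.

Section RMatrixCoefficients.
Variables (z1 z2 lam mu : E) (R : nat -> nat -> nat -> nat -> E).
Hypothesis R00 : forall k l, R 0 0 k l = ((k == 0) && (l == 0))%:R.
Hypothesis Rf : forall a b k l,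
  R a.+1 b k l + R a b.+1 k l =
  (0 < k)%:R * R a b k.-1 l + (0 < l)%:R * R a b k l.-1.
Hypothesis Rfh : forall a b k l,
  b%:R * R a.+1 b k l + (lam - a%:R - (z1 - z2)) * R a b.+1 k l =
  (0 < k)%:R * (mu - l%:R) * R a b k.-1 l +
  (0 < l)%:R * (k%:R - (z1 - z2)) * R a b k l.-1.

(* The recursion two_colour_rec is the action of the operator
   (s t - z2) (f1 + f2) + f1 h2 + (h1 - z1 + z2) f2, which R intertwines
   with its opposite. *)
Lemma two_colour_R (T : {set I}) k l :
  \sum_(S : {set I} | S \subset T)
     two_colour z2 (z1 - lam) T S * R #|S| #|T :\: S| k l =
  \sum_(S : {set I} | S \subset T)
     two_colour z1 (z2 - mu) T S * ((#|S| == l) && (#|T :\: S| == k))%:R.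
Proof.
elim/set_ind: T k l => [|t T tT IH] k l.
  rewrite !(eq_bigl _ _ (fun S => subset0 S)) !big_pred1_eq.
  by rewrite !two_colour0 !mul1r set0D cards0 R00 andbC ![0%N == _]eq_sym.
rewrite (two_colour_rec _ _ (fun a b => R a b k l) tT).
rewrite (two_colour_rec _ _ (fun a b => ((a == l) && (b == k))%:R) tT).
transitivity (\sum_(S : {set I} | S \subset T) (
    (s t - z2 + mu - l%:R) * (0 < k)%:R *
      (two_colour z2 (z1 - lam) T S * R #|S| #|T :\: S| k.-1 l) +
    (s t - z1 + k%:R) * (0 < l)%:R *
      (two_colour z2 (z1 - lam) T S * R #|S| #|T :\: S| k l.-1))).
  apply: eq_bigr => S _; set a := #|S|; set b := #|T :\: S|.
  rewrite [LHS](_ : _ = two_colour z2 (z1 - lam) T S *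
    ((s t - z2) * (R a.+1 b k l + R a b.+1 k l) +
     (b%:R * R a.+1 b k l + (lam - a%:R - (z1 - z2)) * R a b.+1 k l)));
    last by ring.
  by rewrite Rf Rfh; ring.
rewrite big_split /= -!mulr_sumr !IH !mulr_sumr -big_split /=.
apply: eq_bigr => S _; move: #|S| #|T :\: S| => a b.
case: k => [|k]; case: l => [|l] /=;
  rewrite ?eqSS ?andbF /= ?(mulr0, mul0r, mulr0n, addr0, add0r) //.
- by case: (a =P l) => [?|_]; case: (b =P 0%N) => [?|_]; subst=> /=; ring.
- by case: (a =P 0%N) => [?|_]; case: (b =P k) => [?|_]; subst=> /=; ring.
case: (b =P k.+1) => [?|_]; case: (b =P k) => [?|_];
  case: (a =P l.+1) => [?|_]; case: (a =P l) => [?|_]; subst=> /=; ring.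
Qed.

End RMatrixCoefficients.
End TwoColours.

(** * Colourings and the exchange relation *)

Section Pairs.
Variables (B : comPzRingType) (r : nat).

Lemma prod_pairs (g : 'I_r -> 'I_r -> B) : (forall j, g j j = 1) ->
  \prod_j \prod_k g j k = \prod_(j < r) \prod_(k < r | (j < k)%N) (g j k * g k j).
Proof.
move=> gjj; under [RHS]eq_bigr => j _ do rewrite big_split /=.
rewrite big_split /= [X in _ = _ * X](exchange_big_dep predT) //= -big_split /=.
apply: eq_bigr => j _; rewrite (bigID (fun k : 'I_r => (j < k)%N)) /=.
congr (_ * _); rewrite (bigD1 j) ?ltnn //= gjj mul1r.
by apply: eq_bigl => k; rewrite -leqNgt ltn_neqAle andbC.
Qed.

End Pairs.

Section Colourings.
Variables (C : finType) (r : nat).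

Definition ncol (c : 'I_r -> C) (k : C) : nat := #|[set t | c t == k]|.

(** The pair factor is [s k - s j] times the fraction [1 + 1 / (s j - s k)] or [1 + 1 / (s k - s j)]
    of [colour_frac], and the two truth values choose which. Being free of denominators, it makes
    sense in any ring and commutes with ring morphisms. *)
Definition colour_poly (B : pzRingType) (w : C -> B -> B) (lt : rel C)
    (s : 'I_r -> B) (c : 'I_r -> C) : B :=
  (\prod_j w (c j) (s j)) *
  \prod_(j < r) \prod_(k < r | (j < k)%N)
    (s k - s j + (lt (c k) (c j))%:R - (lt (c j) (c k))%:R).

Definition colour_frac (E : fieldType) (w : C -> E -> E) (lt : rel C)
    (s : 'I_r -> E) (c : 'I_r -> C) : E :=
  (\prod_j w (c j) (s j)) *
  \prod_j \prod_(k | lt (c j) (c k)) (1 + 1 / (s j - s k)).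

Lemma colour_poly_frac (E : fieldType) (w : C -> E -> E) (lt : rel C)
    (s : 'I_r -> E) (c : 'I_r -> C) :
  injective s -> (forall x, ~~ lt x x) -> (forall x y, lt x y -> ~~ lt y x) ->
  colour_poly w lt s c =
  (\prod_(j < r) \prod_(k < r | (j < k)%N) (s k - s j)) * colour_frac w lt s c.
Proof.
move=> inj_s ltxx ltC; rewrite /colour_poly /colour_frac mulrCA; congr (_ * _).
pose g j k := if lt (c j) (c k) then 1 + 1 / (s j - s k) else 1.
have -> : \prod_j \prod_(k | lt (c j) (c k)) (1 + 1 / (s j - s k)) =
    \prod_j \prod_k g j k.
  by apply: eq_bigr => j _; rewrite big_mkcond.
rewrite prod_pairs => [|j]; last by rewrite /g (negPf (ltxx _)).
rewrite -big_split /=; apply: eq_bigr => j _; rewrite -big_split /=.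
apply: eq_bigr => k ltjk.
have kj : s k - s j != 0.
  by rewrite subr_eq0 (inj_eq inj_s); apply: contraTneq ltjk => ->; rewrite ltnn.
have jk : s j - s k != 0 by rewrite -opprB oppr_eq0.
rewrite /g; case: (boolP (lt (c j) (c k))) => [/ltC/negPf -> /=|_].
  by rewrite mulr0n addr0 mulr1; field.
by case: (lt (c k) (c j)) => /=; rewrite ?mulr0n ?subr0 ?addr0 ?mulr1 //; field.
Qed.

Lemma rmorph_colour_poly (A B : pzRingType) (phi : {rmorphism A -> B})
    (wA : C -> A -> A) (wB : C -> B -> B) (lt : rel C)
    (s : 'I_r -> A) (c : 'I_r -> C) :
  (forall k x, phi (wA k x) = wB k (phi x)) ->
  phi (colour_poly wA lt s c) = colour_poly wB lt (phi \o s) c.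
Proof.
move=> phiw; rewrite rmorphM !rmorph_prod; congr (_ * _).
  by apply: eq_bigr => j _; rewrite phiw.
apply: eq_bigr => j _; rewrite rmorph_prod; apply: eq_bigr => k _.
by rewrite rmorphB rmorphD rmorphB !rmorph_nat.
Qed.

Lemma eq_colour_poly (B : pzRingType) (w w' : C -> B -> B) (lt lt' : rel C)
    (s s' : 'I_r -> B) (c c' : 'I_r -> C) :
  (forall k, w k =1 w' k) -> lt =2 lt' -> s =1 s' -> c =1 c' ->
  colour_poly w lt s c = colour_poly w' lt' s' c'.
Proof.
move=> eqw eqlt eqs eqc; congr (_ * _); apply: eq_bigr => j _.
  by rewrite eqw eqs eqc.
by apply: eq_bigr => k _; rewrite !eqlt !eqs !eqc.
Qed.

End Colourings.

Section Exchange.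
Variables (C : finType) (r : nat) (E : fieldType) (s : 'I_r -> E).
Hypothesis inj_s : injective s.

(** In both orders to be compared, [i] and [j] are neighbours, so no other colour can tell them
    apart by the order. After their identification both sides share the weights [w0] and the order
    [lt0]. *)
Definition erase (i j k : C) : option C :=
  if (k == i) || (k == j) then None else Some k.

Section Erase.
Variables (w : C -> E -> E) (lt : rel C) (i j : C) (al be : E).
Variables (w0 : option C -> E -> E) (lt0 : rel (option C)).
Hypothesis neq_ij : i != j.
Hypothesis w_i : forall x, w i x = w0 None x * (x - al).
Hypothesis w_j : forall x, w j x = w0 None x * (x - be).
Hypothesis w_k : forall k x, k != i -> k != j -> w k x = w0 (Some k) x.
Hypothesis lt_ij : [/\ lt i j, ~~ lt j i, ~~ lt i i & ~~ lt j j].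
Hypothesis ltE : forall k l, ~~ ((erase i j k == None) && (erase i j l == None)) ->
  lt k l = lt0 (erase i j k) (erase i j l).

Definition erased_frac (c0 : 'I_r -> option C) : E :=
  (\prod_t w0 (c0 t) (s t)) *
  \prod_t \prod_(t' | ~~ ((c0 t == None) && (c0 t' == None)) && lt0 (c0 t) (c0 t'))
    (1 + 1 / (s t - s t')).

Definition recolour (c0 : 'I_r -> option C) (S : {set 'I_r}) : {ffun 'I_r -> C} :=
  [ffun t => if c0 t is Some k then k else if t \in S then i else j].

Lemma colour_frac_recolour (c0 : 'I_r -> option C) (S : {set 'I_r}) :
  (forall t, c0 t != Some i) -> (forall t, c0 t != Some j) ->
  S \subset [set t | c0 t == None] ->
  colour_frac w lt s (recolour c0 S) =
  erased_frac c0 * two_colour s al be [set t | c0 t == None] S.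
Proof.
move=> c0i c0j sST; set T := [set t | _].
have er t : erase i j (recolour c0 S t) = c0 t.
  rewrite /erase ffunE; case c0t : (c0 t) => [k|].
    by have := c0i t; have := c0j t; rewrite c0t => /negPf kj /negPf ki;
       rewrite [k == i]ki [k == j]kj.
  by case: (t \in S); rewrite eqxx ?orbT.
rewrite /colour_frac /erased_frac /two_colour.
have -> : \prod_t w (recolour c0 S t) (s t) =
  (\prod_t w0 (c0 t) (s t)) *
  ((\prod_(t in S) (s t - al)) * \prod_(t in T :\: S) (s t - be)).
  rewrite [\prod_(t in S) _]big_mkcond [\prod_(t in T :\: S) _]big_mkcond.
  rewrite -!big_split /=; apply: eq_bigr => t _.
  rewrite ffunE inE; case: (boolP (t \in T)) => tT /=.
    have /eqP c0t : c0 t == None by move: tT; rewrite inE.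
    by rewrite c0t; case: (t \in S); rewrite ?w_i ?w_j ?mulr1 ?mul1r.
  rewrite (negPf (contra (subsetP sST t) tT)) /= !mulr1.
  move: tT; rewrite inE; case c0t : (c0 t) => [k|] // _.
  apply: w_k; first by apply: contraNneq (c0i t) => <-; rewrite c0t.
  by apply: contraNneq (c0j t) => <-; rewrite c0t.
rewrite -[LHS]mulrA -[RHS]mulrA; congr (_ * _); rewrite [RHS]mulrCA; congr (_ * _).
rewrite [X in _ = _ * X](_ : _ = \prod_t \prod_(t' | (t \in S) && (t' \in T :\: S))
    (1 + 1 / (s t - s t'))); last first.
  rewrite [LHS]big_mkcond; apply: eq_bigr => t _; case: (t \in S) => //=.
  by rewrite big_pred0.
rewrite -big_split; apply: eq_bigr => t _ /=.
rewrite (bigID (fun t' => (c0 t == None) && (c0 t' == None))) /= [RHS]mulrC.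
congr (_ * _); last first.
  apply: eq_bigl => t'; case: (boolP (~~ ((c0 t == None) && (c0 t' == None)))) => nT.
    by rewrite andbT ltE !er.
  by rewrite andbF.
apply: eq_bigl => t'; rewrite !inE.
case c0t : (c0 t) => [k|] /=; rewrite ?andbF.
  by apply/esym/negP => /andP[/(subsetP sST)]; rewrite inE c0t.
case c0t' : (c0 t') => [k|] /=; rewrite ?andbF ?andbT //.
rewrite !ffunE c0t c0t'; case: lt_ij => ij /negPf ji /negPf ii /negPf jj.
by case: (t \in S); case: (t' \in S).
Qed.

(* With the colours i and j identified, the remaining freedom in c is the
   subset of the variables of colour i. *)
Lemma sum_erase (c0 : {ffun 'I_r -> option C}) (G : nat -> nat -> E) :
  (forall t, c0 t != Some i) -> (forall t, c0 t != Some j) ->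
  \sum_(c : {ffun 'I_r -> C} | [ffun t => erase i j (c t)] == c0)
     colour_frac w lt s c * G (ncol c i) (ncol c j) =
  erased_frac c0 * \sum_(S : {set 'I_r} | S \subset [set t | c0 t == None])
     two_colour s al be [set t | c0 t == None] S *
     G #|S| #|[set t | c0 t == None] :\: S|.
Proof.
move=> c0i c0j; set T := [set t | _].
rewrite (reindex_onto (recolour c0) (fun c : {ffun 'I_r -> C} => [set t | c t == i])) /=;
  last first.
  move=> c /eqP <-; apply/ffunP => t; rewrite !ffunE /erase inE.
  by case: (eqVneq (c t) i) => [->|_] //=; case: (eqVneq (c t) j) => [->|_].
have nc (S : {set 'I_r}) : S \subset T ->
    [set t | recolour c0 S t == i] = S /\ [set t | recolour c0 S t == j] = T :\: S.
  move=> sST; split; apply/setP => t; rewrite !inE ffunE; case c0t : (c0 t) => [k|] /=.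
  - have := c0i t; rewrite c0t => /negPf E1; rewrite [k == i]E1.
    by apply/esym/negP => /(subsetP sST); rewrite inE c0t.
  - by case: (t \in S); rewrite ?eqxx // eq_sym (negPf neq_ij).
  - by have := c0j t; rewrite c0t andbF => /negPf.
  - by rewrite andbT; case: (t \in S); rewrite ?eqxx // (negPf neq_ij).
rewrite mulr_sumr; apply: eq_big => S.
  apply/andP/idP => [[_ /eqP <-]|sST].
    apply/subsetP => t; rewrite !inE ffunE; case c0t : (c0 t) => [k|] //= /eqP ki.
    by have := c0i t; rewrite c0t ki eqxx.
  split; last by have [-> _] := nc S sST.
  apply/eqP/ffunP => t; rewrite !ffunE /erase; case c0t : (c0 t) => [k|].
    by have := c0i t; have := c0j t; rewrite c0t => /negPf kj /negPf ki;
       rewrite [k == i]ki [k == j]kj.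
  by case: (t \in S); rewrite eqxx ?orbT.
move=> /andP[_ /eqP eS].
have sST : S \subset T.
  rewrite -eS; apply/subsetP => t; rewrite !inE ffunE.
  case c0t : (c0 t) => [k|] //= /eqP ki.
  by have := c0i t; rewrite c0t ki eqxx.
rewrite colour_frac_recolour // mulrA /ncol.
by have [-> ->] := nc S sST.
Qed.

End Erase.

Lemma ncol_erase (i j k : C) (c : 'I_r -> C) : k != i -> k != j ->
  ncol c k = ncol (fun t => erase i j (c t)) (Some k).
Proof.
move=> ki kj; apply: eq_card => t; rewrite !inE /erase.
case: eqVneq => [->|ck] /=; first by rewrite (negPf ki) (negPf kj) eqxx.
by case: ifP => // _; apply/esym/negbTE; apply: contraNneq ck => -[->].
Qed.

Variables (w w' : C -> E -> E) (lt lt' : rel C) (i j : C) (zi zj lam mu : E).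
Variables (w0 : option C -> E -> E) (lt0 : rel (option C)).
Hypothesis neq_ij : i != j.
Hypothesis w_i : forall x, w i x = w0 None x * (x - zj).
Hypothesis w_j : forall x, w j x = w0 None x * (x - (zi - lam)).
Hypothesis w'_i : forall x, w' i x = w0 None x * (x - (zj - mu)).
Hypothesis w'_j : forall x, w' j x = w0 None x * (x - zi).
Hypothesis w_k : forall k x, k != i -> k != j -> w k x = w0 (Some k) x.
Hypothesis w'_k : forall k x, k != i -> k != j -> w' k x = w0 (Some k) x.
Hypothesis lt_ij : [/\ lt i j, ~~ lt j i, ~~ lt i i & ~~ lt j j].
Hypothesis lt'_ji : [/\ lt' j i, ~~ lt' i j, ~~ lt' j j & ~~ lt' i i].
Hypothesis ltE : forall k l, ~~ ((erase i j k == None) && (erase i j l == None)) ->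
  lt k l = lt0 (erase i j k) (erase i j l).
Hypothesis lt'E : forall k l, ~~ ((erase i j k == None) && (erase i j l == None)) ->
  lt' k l = lt0 (erase i j k) (erase i j l).
Variable (R : nat -> nat -> nat -> nat -> E).
Hypothesis R00 : forall k l, R 0 0 k l = ((k == 0) && (l == 0))%:R.
Hypothesis Rf : forall a b k l,
  R a.+1 b k l + R a b.+1 k l =
  (0 < k)%:R * R a b k.-1 l + (0 < l)%:R * R a b k l.-1.
Hypothesis Rfh : forall a b k l,
  b%:R * R a.+1 b k l + (lam - a%:R - (zi - zj)) * R a b.+1 k l =
  (0 < k)%:R * (mu - l%:R) * R a b k.-1 l +
  (0 < l)%:R * (k%:R - (zi - zj)) * R a b k l.-1.

Definition agree_off (u v : C -> nat) :=
  [forall k, (k != i) && (k != j) ==> (u k == v k)].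

(** For a fixed erased colouring both sums are [erased_frac] times a two-colour sum, to which
    [two_colour_R] applies. The condition [agree_off] expresses that R acts as the identity on the
    remaining tensor factors. *)
Lemma exchange (v : C -> nat) :
  \sum_(c : {ffun 'I_r -> C}) colour_frac w lt s c *
     ((agree_off (ncol c) v)%:R * R (ncol c i) (ncol c j) (v i) (v j)) =
  \sum_(c : {ffun 'I_r -> C} | [forall k, ncol c k == v k]) colour_frac w' lt' s c.
Proof.
pose er (c : {ffun 'I_r -> C}) := [ffun t => erase i j (c t)].
pose ok (c0 : {ffun 'I_r -> option C}) :=
  [forall t, (c0 t != Some i) && (c0 t != Some j)].
have er_ok c : ok (er c).
  apply/forallP => t; rewrite ffunE /erase; case: ifPn => //.
  rewrite negb_or => /andP[ci cj].
  by apply/andP; split; [apply: contraNneq ci => -[->] | apply: contraNneq cj => -[->]].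
rewrite [RHS]big_mkcond (partition_big er ok) //= [RHS](partition_big er ok) //=.
apply: eq_bigr => c0 /forallP okc0.
have c0i t : c0 t != Some i by case/andP: (okc0 t).
have c0j t : c0 t != Some j by case/andP: (okc0 t).
pose off := [forall k, (k != i) && (k != j) ==> (ncol c0 (Some k) == v k)].
have offE c : er c = c0 -> agree_off (ncol c) v = off.
  move=> cE; rewrite /off -cE; apply: eq_forallb => k.
  case: (boolP (_ && _)) => //= /andP[ki kj].
  rewrite (ncol_erase c ki kj); congr (_ == _).
  by apply: eq_card => t; rewrite !inE ffunE.
transitivity (\sum_(c | er c == c0) colour_frac w lt s c *
    (off%:R * R (ncol c i) (ncol c j) (v i) (v j))).
  by apply: eq_bigr => c /eqP cE; rewrite (offE c cE).
rewrite (sum_erase neq_ij w_i w_j w_k lt_ij ltE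
  (fun a b => off%:R * R a b (v i) (v j)) c0i c0j).
transitivity (\sum_(c | er c == c0) colour_frac w' lt' s c *
    (off%:R * ((ncol c j == v j) && (ncol c i == v i))%:R)); last first.
  apply: eq_bigr => c /eqP cE; rewrite -natrM mulnb mulr_natr mulrb.
  congr (if _ then _ else _).
  rewrite -(offE c cE); apply/and3P/forallP => [[/forallP oc /eqP jc /eqP ic] k|oc].
    case: (eqVneq k i) => [->|ki]; first by rewrite ic.
    case: (eqVneq k j) => [->|kj]; first by rewrite jc.
    by have := oc k; rewrite ki kj.
  by split=> //; apply/forallP => k; rewrite oc implybT.
have sw k : erase j i k = erase i j k by rewrite /erase orbC.
(* In the order [lt'] the colour [j] comes first, so the subset now collects the variables of colour
   [j], and the two colours change roles. *)
have := @sum_erase w' lt' j i zi (zj - mu) w0 lt0 _ w'_j w'_i _ lt'_ji _ c0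
  (fun a b => off%:R * ((a == v j) && (b == v i))%:R) c0j c0i.
rewrite (eq_bigl (fun c => er c == c0)); last first.
  by move=> c; congr (_ == _); apply/ffunP => t; rewrite !ffunE sw.
move=> -> //; last 3 first.
- by rewrite eq_sym.
- by move=> k x ki kj; apply: w'_k.
- by move=> k l; rewrite !sw; apply: lt'E.
congr (_ * _).
under eq_bigr do rewrite mulrCA.
under [RHS]eq_bigr do rewrite mulrCA.
by rewrite -!mulr_sumr (two_colour_R inj_s R00 Rf Rfh).
Qed.

End Exchange.

(** * Symmetrization *)

Local Notation lift := fintype.lift.

Section Insert.
Variables (C : finType) (r : nat).

Definition insert (t : 'I_r.+1) (i : C) (c : 'I_r -> C) : {ffun 'I_r.+1 -> C} :=
  [ffun t' => if unlift t t' is Some k then c k else i].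

Lemma insert_id t i c : insert t i c t = i.
Proof. by rewrite ffunE unlift_none. Qed.

Lemma insert_lift t i c k : insert t i c (lift t k) = c k.
Proof. by rewrite ffunE liftK. Qed.

Lemma ncol_sum m (c : 'I_m -> C) k : ncol c k = (\sum_t (c t == k))%N.
Proof.
by rewrite /ncol -sum1_card big_mkcond; apply: eq_bigr => t _; rewrite inE; case: eqP.
Qed.

Lemma ncol_lift (t : 'I_r.+1) (c : 'I_r.+1 -> C) k :
  ncol c k = ((c t == k) + ncol (c \o lift t) k)%N.
Proof. by rewrite !ncol_sum (bigD1_ord t). Qed.

Lemma ncol_insert t i c k : ncol (insert t i c) k = ((i == k) + ncol c k)%N.
Proof.
rewrite (ncol_lift t) insert_id; congr (_ + _)%N.
by apply: eq_card => l; rewrite !inE /= insert_lift.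
Qed.

Lemma sum_insert (V : nmodType) (t : 'I_r.+1) (i : C) (P : pred {ffun 'I_r.+1 -> C})
    (F : {ffun 'I_r.+1 -> C} -> V) :
  \sum_(c : {ffun 'I_r.+1 -> C} | P c && (c t == i)) F c =
  \sum_(c : {ffun 'I_r -> C} | P (insert t i c)) F (insert t i c).
Proof.
rewrite (reindex_onto (fun c : {ffun 'I_r -> C} => insert t i c)
                      (fun c : {ffun 'I_r.+1 -> C} => [ffun k => c (lift t k)])) /=.
  apply: eq_bigl => c; rewrite insert_id eqxx andbT andbC.
  by rewrite (_ : _ == c) //; apply/eqP/ffunP => k; rewrite ffunE insert_lift.
move=> c /andP[_ /eqP cti]; apply/ffunP => k; rewrite ffunE.
by case: unliftP => [l ->|->]; rewrite ?ffunE.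
Qed.

Lemma colour_frac_insert (E : fieldType) (w : C -> E -> E) (lt : rel C)
    (s : 'I_r.+1 -> E) t i (c : 'I_r -> C) : ~~ lt i i ->
  colour_frac w lt s (insert t i c) =
  colour_frac w lt (s \o lift t) c *
  (w i (s t) * (\prod_(k | lt i (c k)) (1 + 1 / (s t - s (lift t k)))) *
   \prod_(k | lt (c k) i) (1 + 1 / (s (lift t k) - s t))).
Proof.
move=> ltii; rewrite /colour_frac (bigD1_ord t) //=.
rewrite [X in _ * X = _](bigD1_ord t) //= insert_id.
rewrite (eq_bigr (fun k => w (c k) (s (lift t k)))); last first.
  by move=> k _; rewrite insert_lift.
rewrite [X in _ * (X * _) = _]big_mkcond (bigD1_ord t) //= insert_id (negPf ltii) mul1r.
rewrite [X in _ * (X * _) = _](_ : _ =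
    \prod_(k | lt i (c k)) (1 + 1 / (s t - s (lift t k)))).
  rewrite [X in _ * (_ * X) = _](eq_bigr (fun k =>
      (if lt (c k) i then 1 + 1 / (s (lift t k) - s t) else 1) *
      \prod_(k' | lt (c k) (c k')) (1 + 1 / (s (lift t k) - s (lift t k'))))).
    rewrite big_split /= -big_mkcond /=. by ring.
  move=> k _; rewrite big_mkcond (bigD1_ord t) //= insert_id insert_lift.
  congr (_ * _); rewrite [RHS]big_mkcond; apply: eq_bigr => k' _.
  by rewrite insert_lift.
rewrite [RHS]big_mkcond; apply: eq_bigr => k' _.
by rewrite insert_lift.
Qed.

End Insert.

Lemma sum_lift_perm (V : nmodType) r (F : 'S_r.+1 -> V) :
  \sum_sg F sg = \sum_t \sum_(sg : 'S_r) F (lift_perm ord0 t sg).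
Proof.
rewrite pair_big /=.
rewrite (reindex (fun q : 'I_r.+1 * 'S_r => lift_perm ord0 q.1 q.2)) //.
apply: onW_bij; apply: inj_card_bij; last first.
  by rewrite card_prod card_ord !card_Sn factS.
move=> [t sg] [t' sg'] /= eq_lp.
have tt : t = t' by have /permP/(_ ord0) := eq_lp; rewrite !lift_perm_id.
subst t'; congr pair; apply/permP => k.
by have /permP/(_ (lift ord0 k)) := eq_lp; rewrite !lift_perm_lift => /lift_inj.
Qed.

Section Symmetrization.
Variables (E : fieldType) (n : nat) (w : 'I_n -> E -> E).
Let lt (i j : 'I_n) := (i < j)%N.

Definition ordered_term r (s : 'I_r -> E) (d : 'I_r -> 'I_n) (sg : 'S_r) : E :=
  (\prod_j w (d j) (s (sg j))) *
  \prod_(j < r) \prod_(k < r | (j < k)%N) (1 + 1 / (s (sg j) - s (sg k))).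

Lemma ordered_term_lift_perm r (s : 'I_r.+1 -> E) d t sg :
  ordered_term s d (lift_perm ord0 t sg) =
  w (d ord0) (s t) * (\prod_k (1 + 1 / (s t - s (lift t k)))) *
  ordered_term (s \o lift t) (d \o lift ord0) sg.
Proof.
rewrite /ordered_term !big_ord_recl /= lift_perm_id.
rewrite (eq_bigr (fun j => w (d (lift ord0 j)) (s (lift t (sg j))))); last first.
  by move=> j _; rewrite lift_perm_lift.
rewrite [X in _ * (X * _) = _]big_mkcond big_ord_recl /= mul1r.
rewrite [X in _ * (X * _) = _](eq_bigr (fun j =>
    1 + 1 / (s t - s (lift t (sg j))))); last first.
  by move=> j _; rewrite lift_perm_lift.
rewrite [\prod_k (1 + 1 / (s t - s (lift t k)))](reindex_inj (@perm_inj _ sg)) /=.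
rewrite [X in _ * (_ * X) = _](eq_bigr (fun j : 'I_r => \prod_(k < r | (j < k)%N)
    (1 + 1 / (s (lift t (sg j)) - s (lift t (sg k)))))); first by ring.
move=> j _; rewrite big_mkcond big_ord_recl /= mul1r [RHS]big_mkcond.
by apply: eq_bigr => k _; rewrite !lift_perm_lift ltnS.
Qed.

Lemma sum_ordered_term r (s : 'I_r -> E) (d : 'I_r -> 'I_n) :
  injective s -> (forall j k : 'I_r, (j <= k)%N -> (d j <= d k)%N) ->
  \sum_sg ordered_term s d sg =
  (\prod_i (ncol d i)`!)%:R *
  \sum_(c : {ffun 'I_r -> 'I_n} | [forall i, ncol c i == ncol d i])
    colour_frac w lt s c.
Proof.
elim: r s d => [|r IH] s d inj_s mono_d.
  rewrite [X in X%:R * _]big1 => [|i _]; last by rewrite ncol_sum big_ord0.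
  rewrite mul1r (bigD1 (1%g : 'S_0)) //= big1 => [|sg]; last first.
    by case/eqP; apply/permP => -[].
  rewrite (bigD1 [ffun j => d j]) /=; last first.
    by apply/forallP => i; rewrite !ncol_sum !big_ord0.
  rewrite big1 => [|c /andP[_ /eqP[]]]; last by apply/ffunP => -[].
  by rewrite /ordered_term /colour_frac !big_ord0.
set i := d ord0; set d' := d \o lift ord0.
have ncd k : ncol d k = ((i == k) + ncol d' k)%N by apply: ncol_lift.
have mono_d' (j k : 'I_r) : (j <= k)%N -> (d' j <= d' k)%N.
  by move=> jk; apply: mono_d; rewrite !lift0.
have fact_d : (\prod_k (ncol d k)`! = ncol d i * \prod_k (ncol d' k)`!)%N.
  rewrite (bigD1 i) //= [in RHS](bigD1 i) //= mulnA; congr (_ * _)%N.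
    by rewrite ncd eqxx add1n factS.
  by apply: eq_bigr => k ki; rewrite ncd eq_sym (negPf ki).
rewrite sum_lift_perm fact_d natrM mulrAC mulr_sumr.
transitivity ((\sum_(c : {ffun 'I_r.+1 -> 'I_n} | [forall k, ncol c k == ncol d k])
   \sum_(t | c t == i) pfcoef s 1 [set t | c t == i] t * colour_frac w lt s c) *
   (\prod_k (ncol d' k)`!)%:R); last first.
  congr (_ * _); apply: eq_bigr => c /forallP/(_ i)/eqP <-.
  rewrite -mulr_suml; congr (_ * _); rewrite /ncol -(sum_pfcoef 1 inj_s).
  by apply: eq_bigl => t; rewrite inE.
rewrite [in RHS](exchange_big_dep predT) //= mulr_suml; apply: eq_bigr => t _.
rewrite sum_insert.
rewrite (eq_bigr _ (fun sg _ => ordered_term_lift_perm s d t sg)).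
rewrite -mulr_sumr IH //; last by apply: inj_comp => //; apply: lift_inj.
rewrite [X in _ * X]mulrC mulrA; congr (_ * _); rewrite mulr_sumr.
apply: eq_big => c.
  by apply: eq_forallb => k; rewrite ncol_insert ncd eqn_add2l.
move=> /forallP cd'; rewrite colour_frac_insert; last by rewrite /lt ltnn.
(* Since [d] is monotone, [i = d ord0] is the least colour in use: no variable precedes [s t]. *)
have ge_i k : (i <= c k)%N.
  have : (0 < ncol d' (c k))%N.
    by rewrite -(eqP (cd' _)) ncol_sum (bigD1 k) //= eqxx.
  by case/card_gt0P => j; rewrite inE => /eqP <-; apply: mono_d.
rewrite [X in _ = _ * (_ * (_ * X))]big_pred0 => [|k]; last by rewrite /lt ltnNge ge_i.
have -> : pfcoef s 1 [set t' | insert t i c t' == i] t =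
    \prod_k (if c k == i then 1 + 1 / (s t - s (lift t k)) else 1).
  rewrite /pfcoef big_mkcond (bigD1_ord t) //= eqxx andbF mul1r.
  by apply: eq_bigr => k _; rewrite !inE insert_lift (eq_sym (lift t k)) neq_lift andbT.
rewrite mulr1 mulrC [RHS]mulrCA; congr (_ * _); rewrite [RHS]mulrCA; congr (_ * _).
rewrite [X in _ = _ * X]big_mkcond -big_split; apply: eq_bigr => k _ /=.
rewrite /lt; have := ge_i k; rewrite leq_eqVlt => /orP[/eqP/val_inj <-|ltik].
  by rewrite eqxx ltnn mulr1.
by rewrite ltik -val_eqE /= gtn_eqF // [RHS]mul1r.
Qed.

End Symmetrization.

(** * The weight function as an integral sum over colourings *)

Lemma tofrac_inj (A : idomainType) : injective (@FracField.tofrac A).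
Proof. by move=> x y /eqP; rewrite tofrac_eq => /eqP. Qed.

Section WeightPolynomial.
Variable (n : nat).

Definition ord_lt : rel 'I_n := fun i j => (i < j)%N.

Definition weight_factor (B : comPzRingType) (lt : rel 'I_n) (x lam : 'I_n -> B)
    (i : 'I_n) (y : B) : B :=
  (\prod_(k | lt k i) (y - x k + lam k)) * \prod_(k | lt i k) (y - x k).

Lemma rmorph_weight_factor (A B : comPzRingType) (phi : {rmorphism A -> B})
    (lt : rel 'I_n) x lam i y :
  phi (weight_factor lt x lam i y) =
  weight_factor lt (phi \o x) (phi \o lam) i (phi y).
Proof.
rewrite rmorphM !rmorph_prod; congr (_ * _); apply: eq_bigr => k _.
  by rewrite rmorphD rmorphB.
by rewrite rmorphB.
Qed.

Section Blocks.
Variables (r : nat) (u : 'X_{1..n}).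

Lemma psum_lt (i k : 'I_n) : (i < k)%N -> (psum u i + u i <= psum u k)%N.
Proof.
move=> ik; rewrite /psum [X in (_ <= X)%N](bigID (fun l : 'I_n => (l < i)%N)) /=.
rewrite leq_add //.
  rewrite [X in (_ <= X)%N](eq_bigl (fun l : 'I_n => (l < i)%N)) // => l.
  by case: (ltnP l i) => [li|]; rewrite ?andbF // (ltn_trans li ik).
by rewrite (bigD1 i) /= ?ltnn ?ik // leq_addr.
Qed.

Lemma psum_le_mdeg (i : 'I_n) : (psum u i + u i <= mdeg u)%N.
Proof.
rewrite mdegE [X in (_ <= X)%N](bigID (fun l : 'I_n => (l < i)%N)) /=.
by rewrite leq_add // (bigD1 i) ?ltnn //= leq_addr.
Qed.

Lemma block_exists (j : nat) : (j < mdeg u)%N ->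
  exists i : 'I_n, (psum u i <= j < psum u i + u i)%N.
Proof.
move=> ltj; pose P m := (\sum_(k < n | (k < m)%N) u k)%N.
have exP : exists m, (j < P m)%N.
  exists n; rewrite /P (eq_bigl xpredT) -?mdegE // => k; exact: ltn_ord.
case: (ex_minnP exP) => -[|m]; first by rewrite /P big_pred0.
move=> ltP minP; have lemj : (P m <= j)%N.
  by rewrite leqNgt; apply/negP => /minP; rewrite ltnn.
case: (ltnP m n) => [ltmn|lenm]; last first.
  move: ltP; rewrite /P (eq_bigl (fun k : 'I_n => (k < m)%N)) => [|k].
    by rewrite ltnNge lemj.
  by have km := leq_trans (ltn_ord k) lenm; rewrite km ltnS (ltnW km).
exists (Ordinal ltmn); rewrite [psum u _]/(P m) lemj /=.
move: ltP; rewrite {1}/P (bigD1 (Ordinal ltmn)) //= addnC.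
rewrite (eq_bigl (fun k : 'I_n => (k < m)%N)) // => k.
by rewrite ltnS -val_eqE /= ltn_neqAle andbC.
Qed.

Lemma block_uniq (j : nat) (i k : 'I_n) :
  (psum u i <= j < psum u i + u i)%N -> (psum u k <= j < psum u k + u k)%N ->
  i = k.
Proof.
move=> /andP[ij ji] /andP[kj jk]; apply: val_inj.
case: (ltngtP i k) => // /psum_lt le; [have := leq_trans le kj | have := leq_trans le ij].
  by rewrite leqNgt ji.
by rewrite leqNgt jk.
Qed.

Hypothesis mdeg_u : mdeg u = r.

Lemma block_colouring : {d : 'I_r -> 'I_n |
  forall (j : 'I_r) i, (psum u i <= j < psum u i + u i)%N = (d j == i)}.
Proof.
have ex (j : 'I_r) : exists i : 'I_n, (psum u i <= j < psum u i + u i)%N.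
  by apply: block_exists; rewrite mdeg_u.
exists (fun j => xchoose (ex j)) => j i; have bj := xchooseP (ex j).
by apply/idP/eqP => [bi|<- //]; apply: block_uniq bj bi.
Qed.

Lemma ncol_block (d : 'I_r -> 'I_n) :
  (forall (j : 'I_r) i, (psum u i <= j < psum u i + u i)%N = (d j == i)) ->
  forall i, ncol d i = u i.
Proof.
move=> dE i; rewrite /ncol -sum1_card.
rewrite (eq_bigl (fun j : 'I_r => (psum u i <= j < psum u i + u i)%N)); last first.
  by move=> j; rewrite inE dE.
rewrite -(big_mkord (fun j => (psum u i <= j < psum u i + u i)%N) (fun _ => 1%N)).
have le_r : (psum u i + u i <= r)%N by rewrite -mdeg_u psum_le_mdeg.
rewrite (@big_cat_nat _ _ _ (psum u i)) //=; last first.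
  by rewrite (leq_trans _ le_r) ?leq_addr.
rewrite big_nat_cond big_pred0 ?add0n => [|j]; last first.
  by case: (ltnP j (psum u i)); rewrite ?andbF.
rewrite (@big_cat_nat _ _ _ (psum u i + u i)) ?leq_addr //=.
rewrite [X in (_ + X)%N]big_nat_cond [X in (_ + X)%N]big_pred0 => [|j]; last first.
  by case: (leqP (psum u i + u i) j); rewrite ?andbF.
rewrite addn0 big_nat_cond (eq_bigl (fun j => (psum u i <= j < psum u i + u i)%N && true)).
  by rewrite -big_nat_cond sum_nat_const_nat muln1 addKn.
by move=> j; case: (psum u i <= j < psum u i + u i)%N.
Qed.

End Blocks.

Variable (r : nat).

(** The consecutive blocks of positions in W form a monotone colouring [d], so [sum_ordered_term]
    applies and its factorials cancel the prefactor, which needs them invertible. *)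
Lemma weight_coord_colour (E : fieldType) (s : 'I_r -> E) (x lam : 'I_n -> E)
    (u : 'X_{1..n}) :
  (forall m, m.+1%:R != 0 :> E) -> injective s -> mdeg u = r ->
  weight_coord s x lam u =
  \sum_(c : {ffun 'I_r -> 'I_n} | [forall i, ncol c i == u i])
    colour_frac (weight_factor ord_lt x lam) ord_lt s c.
Proof.
move=> char0 inj_s mdeg_u.
have [d dE] := block_colouring mdeg_u.
have mono_d (j k : 'I_r) : (j <= k)%N -> (d j <= d k)%N.
  move=> jk; rewrite leqNgt; apply/negP => /(psum_lt u) le.
  have /andP[_] : (psum u (d k) <= k < psum u (d k) + u (d k))%N by rewrite dE.
  have /andP[] : (psum u (d j) <= j < psum u (d j) + u (d j))%N by rewrite dE.
  move=> dj _ dk; have := leq_trans dk (leq_trans le dj).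
  by rewrite ltnNge jk.
have nd := ncol_block mdeg_u dE.
have := sum_ordered_term (weight_factor ord_lt x lam) inj_s mono_d.
under eq_bigr do rewrite nd.
rewrite [X in _ = _ * X](eq_bigl (fun c : {ffun 'I_r -> 'I_n} =>
  [forall i, ncol c i == u i])); last by move=> c; apply: eq_forallb => i; rewrite nd.
move=> sumE; rewrite /weight_coord.
have fact0 : (\prod_i ((u i)`!)%:R : E) != 0.
  apply/prodf_neq0 => i _; have := fact_gt0 (u i).
  by case: (_`!)%N => // m _; apply: char0.
apply: (mulfI fact0); rewrite mulrA divff // mul1r.
rewrite natr_prod in sumE; rewrite -[RHS]sumE; apply: eq_bigr => sg _.
rewrite /ordered_term; congr (_ * _).
  rewrite (eq_bigr (fun i => \prod_j (if d j == i
    then weight_factor ord_lt x lam i (s (sg j)) else 1))); last first.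
    move=> i _; rewrite big_mkcond; apply: eq_bigr => j _; rewrite dE.
    by case: eqP.
  rewrite exchange_big; apply: eq_bigr => j _.
  rewrite (bigD1 (d j)) //= eqxx big1 ?mulr1 // => i /negPf.
  by rewrite eq_sym => ->.
apply: eq_bigr => j _; apply: eq_bigr => k jk.
rewrite mulrDl divff // subr_eq0 (inj_eq inj_s) (inj_eq perm_inj).
by apply: contraTneq jk => ->; rewrite ltnn.
Qed.

Lemma int_eval_var (B : comNzRingType) (s : 'I_r -> B) (x lam : 'I_n -> B) :
  [/\ forall j, int_eval s x lam 'X_(svar n j) = s j,
      forall i, int_eval s x lam 'X_(xvar r i) = x i &
      forall i, int_eval s x lam 'X_(lvar r i) = lam i].
Proof.
split=> i; rewrite /int_eval mmapX mmap1U.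
- rewrite /svar; case: splitP => [k /= E1|k /= E1].
    have -> : k = lshift n i by apply: val_inj; rewrite /= -E1.
    case: splitP => [l /= E2|l /= E2]; first by congr s; apply: val_inj.
    by have := ltn_ord i; rewrite E2 ltnNge leq_addr.
  by have := ltn_ord i; rewrite E1 -addnA ltnNge leq_addr.
- rewrite /xvar; case: splitP => [k /= E1|k /= E1].
    have -> : k = rshift r i by apply: val_inj; rewrite /= -E1.
    case: splitP => [l /= E2|l /= E2].
      by have := ltn_ord l; rewrite -E2 ltnNge leq_addr.
    by congr x; apply: val_inj; apply/eqP; rewrite -(eqn_add2l r) E2.
  by have := ltn_ord i; rewrite -(ltn_add2l r) E1 ltnNge leq_addr.
- rewrite /lvar; case: splitP => [k /= E1|k /= E1].
    by have := ltn_ord k; rewrite -E1 ltnNge leq_addr.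
  by congr lam; apply: val_inj; apply/eqP; rewrite -(eqn_add2l (r + n)) E1.
Qed.

(** The factorials are invertible in the fraction field of the integer polynomials, so the identity
    is proved there. After multiplication by the differences of the [s j] both sides are integer
    polynomials, which can then be evaluated in a ring of any characteristic. *)
Lemma weight_polynomial (W : 'X_{1..n} -> {mpoly int[r + n + n]})
    (B : comNzRingType) (s : 'I_r -> B) (x lam : 'I_n -> B) (u : 'X_{1..n}) :
  is_weight W -> mdeg u = r ->
  (\prod_(j < r) \prod_(k < r | (j < k)%N) (s k - s j)) * int_eval s x lam (W u) =
  \sum_(c : {ffun 'I_r -> 'I_n} | [forall i, ncol c i == u i])
    colour_poly (weight_factor ord_lt x lam) ord_lt s c.
Proof.
move=> hW mdeg_u.
pose A := {mpoly int[r + n + n]}.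
pose S (j : 'I_r) : A := 'X_(svar n j).
pose X (i : 'I_n) : A := 'X_(xvar r i).
pose La (i : 'I_n) : A := 'X_(lvar r i).
have idA : (\prod_(j < r) \prod_(k < r | (j < k)%N) (S k - S j)) * W u =
    \sum_(c : {ffun 'I_r -> 'I_n} | [forall i, ncol c i == u i])
    colour_poly (weight_factor ord_lt X La) ord_lt S c.
  apply: (@tofrac_inj A).
  have inj_S : injective (@FracField.tofrac A \o S).
    move=> j k /tofrac_inj E1.
    have := congr1 (mcoeff U_(svar n j)) E1; rewrite !mcoeffXU eqxx.
    case: eqP => [/lshift_inj/lshift_inj -> //|_ /eqP].
    by rewrite oner_eq0.
  have char0 m : m.+1%:R != 0 :> {fraction A}.
    rewrite -(rmorph_nat (@FracField.tofrac A)) tofrac_eq0 -mpolyC_nat mpolyC_eq0.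
    by rewrite Num.Theory.pnatr_eq0.
  rewrite rmorphM /= (hW u mdeg_u) -/S -/X -/La.
  rewrite (weight_coord_colour _ _ char0 inj_S mdeg_u) mulr_sumr rmorph_sum.
  apply: eq_bigr => c _.
  rewrite (rmorph_colour_poly (wB := weight_factor ord_lt (@FracField.tofrac A \o X)
     (@FracField.tofrac A \o La))); last first.
    by move=> k y; rewrite rmorph_weight_factor.
  rewrite colour_poly_frac //; last 2 first.
  - by move=> y; rewrite /ord_lt ltnn.
  - by move=> y z; rewrite /ord_lt -leqNgt => /ltnW.
  congr (_ * _); rewrite rmorph_prod; apply: eq_bigr => j _.
  by rewrite rmorph_prod; apply: eq_bigr => k _; rewrite rmorphB.
have [evS evX evL] := int_eval_var s x lam.
pose ev : {rmorphism A -> B} := GRing.RMorphism.clone _ _ (int_eval s x lam) _.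
have := congr1 ev idA; rewrite rmorphM rmorph_sum rmorph_prod => E1.
transitivity (\sum_(c : {ffun 'I_r -> 'I_n} | [forall i, ncol c i == u i])
   ev (colour_poly (weight_factor ord_lt X La) ord_lt S c)).
  rewrite -E1; congr (_ * _); apply: eq_bigr => j _; rewrite rmorph_prod.
  by apply: eq_bigr => k _; rewrite rmorphB /= evS evS.
apply: eq_bigr => c _.
rewrite (rmorph_colour_poly
  (wB := weight_factor ord_lt (ev \o X) (ev \o La))); last first.
  by move=> k y; rewrite rmorph_weight_factor.
apply: eq_colour_poly => // k y.
by congr (_ * _); apply: eq_bigr => l _ /=; rewrite ?evX ?evL.
Qed.

End WeightPolynomial.

(** * Coefficients in the basis h_k *)

Lemma mnm_ind r (P : 'X_{1..r} -> Prop) :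
  P 0%MM -> (forall i m, P m -> P (m + U_(i))%MM) -> forall m, P m.
Proof.
move=> P0 PU m; have [d] := ubnP (mdeg m); elim: d m => // d IH m ltmd.
have [->//|m0] := eqVneq m 0%MM.
have [i mi] : exists i, m i != 0%N.
  apply/existsP; rewrite -negb_forall; apply: contraNN m0 => /forallP mE.
  by apply/eqP/mnmP => i; rewrite mnm0E; apply/eqP.
rewrite -(submK (m := U_(i)) (m' := m)) ?lep1mP //; apply/PU/IH.
have := mdegD (m - U_(i)) U_(i); rewrite submK ?lep1mP // mdeg1 => E1.
by move: ltmd; rewrite E1 addn1.
Qed.

Section NewtonCoefficients.
Variables (L : comNzRingType) (r : nat) (a : L).
Local Notation B := {mpoly L[r]}.
Implicit Types (k m : 'X_{1..r}) (f : B).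

(* The coefficient of y (y - a) ... (y - (k-1) a) in y^i. *)
Fixpoint newton_coef (i k : nat) : L :=
  if i is i'.+1 then
    (0 < k)%:R * newton_coef i' k.-1 + k%:R * a * newton_coef i' k
  else (k == 0)%:R.

Definition newton_mon k m : L := \prod_j newton_coef (m j) (k j).

(** The coefficient functional is prescribed on monomials and extended linearly. It is thus
    available for every polynomial, with no expansion in the [h_k] at hand. *)
Definition newton k f : L :=
  fglift (newton_mon k : 'X_{1..r} -> L^o) (mpoly_val f).

Lemma newton_is_zmod_morphism k : zmod_morphism (newton k).
Proof.
move=> f g.
exact: (@lift_is_additive L _ L^o (newton_mon k) (mpoly_val f) (mpoly_val g)).
Qed.

HB.instance Definition _ k := GRing.isZmodMorphism.Build B L (newton k)
  (newton_is_zmod_morphism k).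

Lemma newtonX k c m : newton k (c *: 'X_[m]) = c * newton_mon k m.
Proof. by rewrite /newton -MPolyU /= liftU. Qed.

Lemma newtonZ k c f : newton k (c *: f) = c * newton k f.
Proof.
elim/mpolyind: f => [|d m f _ _ IH]; first by rewrite scaler0 !raddf0 mulr0.
by rewrite scalerDr !raddfD /= IH scalerA !newtonX mulrDr mulrA.
Qed.

Lemma newton_monU k m j :
  newton_mon k (m + U_(j)) =
  (0 < k j)%:R * newton_mon (k - U_(j)) m + (k j)%:R * a * newton_mon k m.
Proof.
rewrite /newton_mon !(bigD1 j isT) /= mnmDE mnm1E eqxx addn1 /= mnmBE mnm1E eqxx subn1.
rewrite [in LHS](eq_bigr (fun i => newton_coef (m i) (k i))); last first.
  by move=> i ij; rewrite mnmDE mnm1E eq_sym (negPf ij) addn0.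
rewrite [X in _ = _ * (_ * X) + _](eq_bigr (fun i => newton_coef (m i) (k i))).
  by rewrite mulrDl !mulrA.
by move=> i ij; rewrite mnmBE mnm1E eq_sym (negPf ij) subn0.
Qed.

(** From [y h_i(y) = h_(i+1)(y) + i a h_i(y)]. When [k j = 0] the truncated [k - U_(j)] is
    meaningless, and the factor [(0 < k j)%:R] removes its term. *)
Lemma newton_mulX k j f :
  newton k (f * 'X_j) =
  (0 < k j)%:R * newton (k - U_(j))%MM f + (k j)%:R * a * newton k f.
Proof.
elim/mpolyind: f => [|d m f _ _ IH]; first by rewrite mul0r !raddf0 !mulr0 addr0.
rewrite mulrDl !raddfD /= IH -scalerAl -mpolyXD !newtonX newton_monU; ring.
Qed.

Lemma newton1 k : newton k 1 = (k == 0%MM)%:R.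
Proof.
rewrite -mpolyX0 -[X in newton _ X]scale1r newtonX mul1r /newton_mon.
under eq_bigr => j _ do rewrite mnm0E /=.
have [->|k0] := eqVneq k 0%MM; first by rewrite big1 // => j _; rewrite mnm0E.
have [j kj] : exists j, k j != 0%N.
  apply/existsP; rewrite -negb_forall; apply: contraNN k0 => /forallP kE.
  by apply/eqP/mnmP => i; rewrite mnm0E; apply/eqP.
by rewrite (bigD1 j) //= (negPf kj) mul0r.
Qed.

Definition shift_up (j : 'I_r) : B -> B :=
  mmap (@mpolyC r L) (fun i => 'X_i + (if i == j then a%:MP else 0)).

HB.instance Definition _ j := GRing.RMorphism.copy (shift_up j)
  (mmap (@mpolyC r L) (fun i => 'X_i + (if i == j then a%:MP else 0))).

Lemma shift_upC j c : shift_up j c%:MP = c%:MP.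
Proof. exact: mmapC. Qed.

Lemma shift_upX j i : shift_up j 'X_i = 'X_i + (if i == j then a%:MP else 0).
Proof. by rewrite /shift_up mmapX mmap1U. Qed.

(* h_i(y + a) = h_i(y) + i a h_(i-1)(y) *)
Lemma newton_shift_up k j f :
  newton k (shift_up j f) =
  newton k f + (k j).+1%:R * a * newton (k + U_(j))%MM f.
Proof.
elim/mpolyind: f => [|d m f _ _ IH]; first by rewrite !raddf0 mulr0 addr0.
rewrite !raddfD /= IH.
suff -> : newton k (shift_up j (d *: 'X_[m])) = newton k (d *: 'X_[m]) +
   (k j).+1%:R * a * newton (k + U_(j))%MM (d *: 'X_[m]) by ring.
rewrite -mul_mpolyC rmorphM /= shift_upC !mul_mpolyC !newtonZ.
suff -> : newton k (shift_up j 'X_[m]) = newton k 'X_[m] +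
   (k j).+1%:R * a * newton (k + U_(j))%MM 'X_[m] by ring.
elim/mnm_ind: m k {IH} => [|i m IHm] k.
  rewrite mpolyX0 rmorph1 !newton1 mnmD_eq0 mnm1_eq0 andbF mulr0 addr0 //.
rewrite mpolyXD rmorphM /=.
rewrite shift_upX mulrDr raddfD /= !newton_mulX !IHm mnmDE mnm1E.
case: (eqVneq i j) => [->|ij].
  rewrite /= addn1 [_ * a%:MP]mulrC mul_mpolyC newtonZ IHm addmK.
  rewrite mnmBE mnm1E eqxx subn1 /=.
  case kj : (k j) => [|n] /=; first by rewrite !mul0r !add0r /=; ring.
  rewrite submK ?lep1mP ?kj // -[n.+2%:R]natr1 -[n.+1%:R]natr1; ring.
rewrite /= mulr0 raddf0 addr0 addn0 mnmBE mnm1E (negPf ij) subn0.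
case ki : (k i) => [|n] /=; first by ring.
have -> : (k + U_(j) - U_(i) = k - U_(i) + U_(j))%MM.
  apply/mnmP => l; rewrite !mnmE; case: (eqVneq i l) => [<-|_]; last by rewrite !subn0.
  by rewrite [j == i]eq_sym (negPf ij) !addn0.
by ring.
Qed.

Definition shift_set (S : {set 'I_r}) : B -> B :=
  mmap (@mpolyC r L) (fun i => 'X_i - (if i \in S then a%:MP else 0)).

HB.instance Definition _ S := GRing.RMorphism.copy (shift_set S)
  (mmap (@mpolyC r L) (fun i => 'X_i - (if i \in S then a%:MP else 0))).

Lemma shift_setC S c : shift_set S c%:MP = c%:MP.
Proof. exact: mmapC. Qed.

Lemma shift_setX S i : shift_set S 'X_i = 'X_i - (if i \in S then a%:MP else 0).
Proof. by rewrite /shift_set mmapX mmap1U. Qed.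

(** A shift by [+ a] changes a coefficient by a single term, which the hypothesis kills, while a
    shift by [- a] would produce many. Hence the variables are treated one at a time, by undoing
    their shift with [shift_up]. *)
Lemma newton_shift_set k S f : (forall j, (k j).+1%:R * a = 0) ->
  newton k (shift_set S f) = newton k f.
Proof.
move=> ka; elim/set_ind: S => [|j S jS IH].
  rewrite [shift_set _ _](_ : _ = f) //.
  rewrite /shift_set /mmap [RHS]mpolyE; apply: eq_bigr => m _.
  rewrite mul_mpolyC -mmap1_id; congr (_ *: _); apply: mmap1_eq => i.
  by rewrite inE subr0.
rewrite -IH -[RHS](_ : newton k (shift_up j (shift_set (j |: S) f)) = _).
  by rewrite newton_shift_up ka mul0r addr0.
congr newton; rewrite /shift_set /mmap rmorph_sum; apply: eq_bigr => m _.
rewrite rmorphM /= shift_upC; congr (_ * _).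
rewrite /mmap1 rmorph_prod; apply: eq_bigr => i _; rewrite rmorphXn rmorphB /=.
congr (_ ^+ _); rewrite shift_upX !inE.
case: (eqVneq i j) => [->|ij] /=.
  by rewrite shift_upC addrK (negPf jS) subr0.
by rewrite addr0; case: ifP => _; rewrite ?rmorph0 // shift_upC.
Qed.

End NewtonCoefficients.

(** * The master function and its difference equation *)

Section PrimeField.
Variables (p : nat) (B : pzRingType).
Hypothesis pr_p : prime p.
Hypothesis p0 : p%:R = 0 :> B.

Lemma natr_modp k : (k %% p)%:R = k%:R :> B.
Proof. by rewrite {2}(divn_eq k p) natrD mulnC natrM p0 mul0r add0r. Qed.

Lemma of_Fp_nat k : of_Fp B (k%:R : 'F_p) = k%:R.
Proof. by rewrite /of_Fp val_Fp_nat // natr_modp. Qed.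

Lemma of_FpM (x y : 'F_p) : of_Fp B (x * y) = of_Fp B x * of_Fp B y.
Proof.
by rewrite -[x in LHS]natr_Zp -[y in LHS]natr_Zp -natrM of_Fp_nat natrM.
Qed.

Lemma of_FpN (x : 'F_p) : of_Fp B (- x) = - of_Fp B x.
Proof.
apply/eqP; rewrite -addr_eq0 /of_Fp -natrD -of_Fp_nat natrD !natr_Zp addNr.
by rewrite (of_Fp_nat 0).
Qed.

End PrimeField.

Lemma rmorph_of_Fp p (A B : pzRingType) (phi : {rmorphism A -> B}) (x : 'F_p) :
  phi (of_Fp A x) = of_Fp B x.
Proof. exact: rmorph_nat. Qed.

Lemma rmorph_hpoly p (a : 'F_p) (A B : comNzRingType) (phi : {rmorphism A -> B}) k y :
  phi (hpoly a k y) = hpoly a k (phi y).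
Proof.
rewrite rmorph_prod; apply: eq_bigr => i _.
by rewrite rmorphB rmorphM rmorph_nat rmorph_of_Fp.
Qed.

Lemma rmorph_gpoly p (a : 'F_p) (A B : comNzRingType) (phi : {rmorphism A -> B}) y b :
  phi (gpoly a y b) = gpoly a (phi y) b.
Proof. by rewrite rmorph_hpoly rmorphB rmorphD !rmorph_of_Fp. Qed.

Section Master.
Variables (p : nat) (a : 'F_p) (B : comNzRingType).
Hypothesis pr_p : prime p.
Hypothesis p0 : p%:R = 0 :> B.
Hypothesis a0 : a != 0.
Local Notation aB := (of_Fp B a).

(** Both sides are the full product [(y + a)(y + 2a)...(y + b)], where [b] is [fbar a b] times [a];
    [gpoly a y b] lacks the last factor and [gpoly a (y + aB) b] the first. *)
Lemma gpoly_shift (y : B) b :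
  (y + aB) * gpoly a (y + aB) b = (y + of_Fp B b) * gpoly a y b.
Proof.
have [/andP[b_gt0 _] bE] := fbarP b pr_p a0.
rewrite /gpoly; set N := (fbar a b).-1.
have bN : of_Fp B b = aB * N.+1%:R.
  by rewrite -{1}bE of_FpM // of_Fp_nat // prednK.
rewrite /hpoly.
transitivity (\prod_(i < N.+1) (y + of_Fp B b - i%:R * aB)).
  rewrite big_ord_recr /= mulrC; congr (_ * _).
    by apply: eq_bigr => i _; congr (_ - _); ring.
  by rewrite bN -natr1; ring.
rewrite big_ord_recl mul0r subr0; congr (_ * _); apply: eq_bigr => i _.
by rewrite lift0 -natr1; ring.
Qed.

Definition master_site n (Lam : 'I_n -> 'F_p) (x : 'I_n -> B) (y : B) : B :=
  \prod_m gpoly a (y - x m) (Lam m).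

Definition master_pairs r (s : 'I_r -> B) : B :=
  \prod_(j < r) \prod_(l < r | (j < l)%N) gpoly a (s l - s j + 1) (- 2%:R).

Lemma masterE n r (Lam : 'I_n -> 'F_p) (s : 'I_r -> B) (x : 'I_n -> B) :
  master a Lam s x =
  (\prod_(j < r) \prod_(l < r | (j < l)%N) (s l - s j)) *
  ((\prod_j master_site Lam x (s j)) * master_pairs s).
Proof.
rewrite /master exchange_big mulrCA; congr (_ * _).
by rewrite -big_split /=; apply: eq_bigr => j _; rewrite big_split.
Qed.

(* The variables of colour mc are moved by - a: this turns the rule "mc comes
   last" into "mc comes first". *)
Lemma colour_shift (C : finType) r (mc : C) (lt lt' : rel C)
    (w w' : C -> B -> B) (G G' : B -> B) (s : 'I_r -> B) (c : 'I_r -> C)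
    (T : {rmorphism B -> B}) :
  [/\ forall x, x != mc -> lt x mc, forall x, ~~ lt mc x,
      forall x, x != mc -> lt' mc x, forall x, ~~ lt' x mc &
      forall x y, x != mc -> y != mc -> lt x y = lt' x y] ->
  (forall x y, x != mc -> w' x y * G' y = w x y * G y) ->
  (forall y, w' mc y * G' y = w mc (y - aB) * G (y - aB)) ->
  (forall j, T (s j) = s j - (if c j == mc then aB else 0)) ->
  (forall x y, T (w x y) = w x (T y)) -> (forall y, T (G y) = G (T y)) ->
  colour_poly w' lt' s c * ((\prod_j G' (s j)) * master_pairs s) =
  T (colour_poly w lt s c * ((\prod_j G (s j)) * master_pairs s)).
Proof.
move=> [lt_mc ltmc_ lt'mc lt'_mc ltE] wG wGmc Ts Tw TG.
(* The parameter -2 is the difference between [s k - s j - 1] and [s k - s j + 1], the pair factors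
   of the two orders. With [y = s k - s j + 1] this equation handles a shift of [s j] alone, and
   with [y = s k - aB - s j + 1] a shift of [s k] alone. *)
have gS (y : B) : (y + aB) * gpoly a (y + aB) (- 2%:R) = (y - 2%:R) * gpoly a y (- 2%:R).
  by rewrite gpoly_shift // of_FpN // of_Fp_nat.
have split2 (u v : 'I_r -> B) (f g : 'I_r -> 'I_r -> B) :
    (\prod_j u j * \prod_(j < r) \prod_(k < r | (j < k)%N) f j k) *
    (\prod_j v j * \prod_(j < r) \prod_(k < r | (j < k)%N) g j k) =
    \prod_j (u j * v j) * \prod_(j < r) \prod_(k < r | (j < k)%N) (f j k * g j k).
  rewrite mulrACA big_split; congr (_ * _); rewrite -big_split; apply: eq_bigr => j _.
  by rewrite big_split.
rewrite /colour_poly /master_pairs !split2.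
rewrite rmorphM !rmorph_prod; congr (_ * _); apply: eq_bigr => j _.
  rewrite rmorphM Tw TG Ts; case: eqVneq => [->|cj]; first exact: wGmc.
  by rewrite subr0 wG.
rewrite rmorph_prod; apply: eq_bigr => k _.
rewrite rmorphM rmorphB rmorphD rmorphB !rmorph_nat rmorph_gpoly rmorphD rmorphB.
rewrite rmorph1 !Ts.
case: (eqVneq (c j) mc) => [->|cj]; case: (eqVneq (c k) mc) => [->|ck].
- by rewrite !(negPf (ltmc_ _)) !(negPf (lt'_mc _)); congr (_ * gpoly a _ _); ring.
- rewrite lt_mc // lt'mc // (negPf (ltmc_ _)) (negPf (lt'_mc _)) !subr0 addr0.
  have := gS (s k - s j + 1); rewrite [_ - 2%:R](_ : _ = s k - s j - 1); last by ring.
  move=> <-; rewrite mulr1n [s k - (s j - aB)](_ : _ = s k - s j + aB); last by ring.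
  by congr (_ * gpoly a _ _); ring.
- rewrite lt_mc // lt'mc // (negPf (ltmc_ _)) (negPf (lt'_mc _)) !subr0 addr0.
  have := gS (s k - aB - s j + 1).
  rewrite [_ - 2%:R](_ : _ = s k - aB - s j - 1); last by ring.
  rewrite [_ + 1 + aB](_ : _ = s k - s j + 1); last by ring.
  by move=> <-.
- by rewrite !subr0 !ltE.
Qed.

End Master.

Lemma rmorph_master p (a : 'F_p) (A B : comNzRingType) (phi : {rmorphism A -> B})
    n r (Lam : 'I_n -> 'F_p) (s : 'I_r -> A) (x : 'I_n -> A) :
  phi (master a Lam s x) = master a Lam (phi \o s) (phi \o x).
Proof.
rewrite rmorphM !rmorph_prod; congr (_ * _); apply: eq_bigr => i _.
  rewrite rmorph_prod; apply: eq_bigr => j _.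
  by rewrite rmorph_gpoly rmorphB.
rewrite rmorph_prod; apply: eq_bigr => j _.
by rewrite rmorphM rmorphB rmorph_gpoly rmorphD rmorphB rmorph1.
Qed.

Lemma rmorph_master_site p (a : 'F_p) (A B : comNzRingType) (phi : {rmorphism A -> B})
    n (Lam : 'I_n -> 'F_p) (x : 'I_n -> A) y :
  phi (master_site a Lam x y) = master_site a Lam (phi \o x) (phi y).
Proof.
rewrite rmorph_prod; apply: eq_bigr => i _.
by rewrite rmorph_gpoly rmorphB.
Qed.

Lemma hpolyS p (a : 'F_p) (B : comNzRingType) k (y : B) :
  hpoly a k.+1 y = hpoly a k y * (y - k%:R * of_Fp B a).
Proof. by rewrite /hpoly big_ord_recr. Qed.

(** The functionals [newton] are dual to the products of the [h_k], so they recover Q from any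
    expansion. The factor that [hpolyS] adds is evaluated by [newton_mulX]. *)
Lemma newton_hpoly p (a : 'F_p) (L : comNzRingType) r (k m : 'X_{1..r}) :
  newton (of_Fp L a) k (\prod_(l < r) hpoly a (m l) ('X_l : {mpoly L[r]})) =
  (m == k)%:R.
Proof.
elim/mnm_ind: m k => [|i m IH] k.
  rewrite big1 => [|l _]; last by rewrite mnm0E /hpoly big_ord0.
  by rewrite newton1 eq_sym.
have -> : \prod_(l < r) hpoly a ((m + U_(i))%MM l) ('X_l : {mpoly L[r]}) =
   (\prod_(l < r) hpoly a (m l) ('X_l : {mpoly L[r]})) *
   ('X_i - ((m i)%:R * of_Fp L a)%:MP).
  rewrite !(bigD1 i isT) /= mnmDE mnm1E eqxx addn1 hpolyS mulrAC.
  rewrite mpolyCM rmorph_of_Fp rmorph_nat; congr (_ * _ * _).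
  by apply: eq_bigr => l il; rewrite mnmDE mnm1E eq_sym (negPf il) addn0.
rewrite mulrBr raddfB /= newton_mulX [_ * _%:MP]mulrC mul_mpolyC newtonZ !IH.
rewrite [X in X - _ = _](_ : _ =
  (m + U_(i) == k)%MM%:R + (m i)%:R * of_Fp L a * (m == k)%:R).
  by rewrite addrK.
congr (_ + _); last by case: eqP => [->|_] //; rewrite !mulr0.
case ki : (k i) => [|j].
  rewrite mul0r; case: eqP => // /(congr1 (fun m' : 'X_{1..r} => m' i)).
  by rewrite mnmDE mnm1E eqxx addn1 ki.
rewrite mul1r; congr (_%:R); congr nat_of_bool.
apply/eqP/eqP => [->|<-]; last by rewrite addmK.
by rewrite submK // lep1mP ki.
Qed.

(** * Moving one tensor factor *)

Section MovingColour.
Variables (n : nat) (m : 'I_n).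

(* The order of 'I_n in which m is moved to the place just before t. *)
Definition move_lt (t : nat) : rel 'I_n := fun i k =>
  if i == m then (k != m) && (t <= k)%N
  else if k == m then (i < t)%N else (i < k)%N.

Lemma move_ltxx t i : ~~ move_lt t i i.
Proof. by rewrite /move_lt; case: eqP => //; rewrite ltnn. Qed.

Lemma move_lt_asym t i k : move_lt t i k -> ~~ move_lt t k i.
Proof.
rewrite /move_lt; have [im|im] := eqVneq i m; have [km|km] := eqVneq k m => //=.
- by rewrite -leqNgt.
- by rewrite -ltnNge.
- by rewrite -leqNgt => /ltnW.
Qed.

Lemma move_lt_ord : move_lt m =2 @ord_lt n.
Proof.
move=> i k; rewrite /move_lt /ord_lt; have [->|im] := eqVneq i m.
  by rewrite ltn_neqAle (inj_eq (@ord_inj n)) eq_sym.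
by have [->|] := eqVneq k m.
Qed.

(** The place of [m] itself is counted by [t], so two values of [t] give the natural order: the
    exchanges with larger factors start from [m.+1], and those with smaller ones end at [m]. *)
Lemma move_ltS : move_lt m.+1 =2 move_lt m.
Proof.
move=> i k; rewrite /move_lt; have [im|im] := eqVneq i m.
  have [//|km] := eqVneq k m.
  by rewrite /= ltn_neqAle (inj_eq (@ord_inj n)) eq_sym km.
have [km|//] := eqVneq k m.
by rewrite ltnS leq_eqVlt (inj_eq (@ord_inj n)) (negPf im).
Qed.

Section Exchange.
Variables (B : comPzRingType) (x lam : 'I_n -> B) (j : 'I_n).
Hypothesis jm : j != m.

Definition move_weight (y : B) : B :=
  (\prod_(k | (k != m) && (k < j)%N) (y - x k + lam k)) *
  \prod_(k | (k != m) && (j < k)%N) (y - x k).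

Lemma weight_factor_move_m y :
  weight_factor (move_lt j) x lam m y = move_weight y * (y - x j).
Proof.
rewrite /weight_factor /move_weight -mulrA; congr (_ * _).
  by apply: eq_bigl => k; rewrite /move_lt eqxx; case: (k == m).
rewrite (bigD1 j) /=; last by rewrite /move_lt eqxx jm leqnn.
rewrite mulrC; congr (_ * _); apply: eq_bigl => k.
rewrite /move_lt eqxx [in RHS]ltn_neqAle (inj_eq (@ord_inj n)) (eq_sym j k) -andbA.
by congr (_ && _); rewrite andbC.
Qed.

Lemma weight_factor_moved_m y :
  weight_factor (move_lt j.+1) x lam m y = move_weight y * (y - x j + lam j).
Proof.
rewrite /weight_factor /move_weight [RHS]mulrAC; congr (_ * _); last first.
  by apply: eq_bigl => k; rewrite /move_lt eqxx.
rewrite (bigD1 j) /=; last by rewrite /move_lt (negPf jm) eqxx leqnn.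
rewrite mulrC; congr (_ * _); apply: eq_bigl => k.
rewrite /move_lt eqxx; have [//|km /=] := eqVneq k m.
by rewrite ltnS [in RHS]ltn_neqAle (inj_eq (@ord_inj n)) andbC.
Qed.

Lemma weight_factor_move_j y :
  weight_factor (move_lt j) x lam j y = move_weight y * (y - x m + lam m).
Proof.
rewrite /weight_factor /move_weight [RHS]mulrAC; congr (_ * _); last first.
  apply: eq_bigl => k; rewrite /move_lt (negPf jm).
  by have [->|//] := eqVneq k m; rewrite ltnn.
rewrite (bigD1 m) /=; last by rewrite /move_lt eqxx jm leqnn.
rewrite mulrC; congr (_ * _); apply: eq_bigl => k.
by rewrite /move_lt (negPf jm) andbC; case: (k == m).
Qed.

Lemma weight_factor_moved_j y :
  weight_factor (move_lt j.+1) x lam j y = move_weight y * (y - x m).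
Proof.
rewrite /weight_factor /move_weight -mulrA; congr (_ * _).
  apply: eq_bigl => k; rewrite /move_lt (negPf jm).
  by have [->|//] := eqVneq k m; rewrite /= ltnn.
rewrite (bigD1 m) /=; last by rewrite /move_lt (negPf jm) eqxx ltnSn.
rewrite mulrC; congr (_ * _); apply: eq_bigl => k.
by rewrite /move_lt (negPf jm) andbC; case: (k == m).
Qed.

Lemma move_ltS_other (k l : 'I_n) :
  ~~ ((erase m j k == None) && (erase m j l == None)) ->
  move_lt j.+1 k l = move_lt j k l.
Proof.
rewrite /erase /move_lt; have [km|km] := eqVneq k m; have [lm|lm] := eqVneq l m => //=.
  have [//|lj _] := eqVneq l j.
  by rewrite ltn_neqAle (inj_eq (@ord_inj n)) eq_sym lj.
have [//|kj _] := eqVneq k j.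
by rewrite ltnS leq_eqVlt (inj_eq (@ord_inj n)) (negPf kj).
Qed.

Lemma weight_factor_move_other k y : k != m -> k != j ->
  weight_factor (move_lt j.+1) x lam k y = weight_factor (move_lt j) x lam k y.
Proof.
move=> km kj; have ek : erase m j k != None by rewrite /erase (negPf km) (negPf kj).
by congr (_ * _); apply: eq_bigl => l; rewrite move_ltS_other //= negb_and ek ?orbT.
Qed.

(** The colour [None], into which [m] and [j] are merged, stands at the place of [j]. *)
Definition move_lt0 : rel (option 'I_n) := fun k l =>
  match k, l with
  | None, None => false
  | None, Some l => (j < l)%N
  | Some k, None => (k < j)%N
  | Some k, Some l => (k < l)%N
  end.

Lemma move_ltE (k l : 'I_n) :
  ~~ ((erase m j k == None) && (erase m j l == None)) ->
  move_lt j k l = move_lt0 (erase m j k) (erase m j l).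
Proof.
rewrite /erase /move_lt; have [km|km] := eqVneq k m; have [lm|lm] := eqVneq l m => //=.
- have [//|lj _ /=] := eqVneq l j.
  by rewrite [RHS]ltn_neqAle (inj_eq (@ord_inj n)) eq_sym lj.
- by have [|] := eqVneq k j.
- by have [->|kj] := eqVneq k j; have [->|lj] := eqVneq l j => //=; rewrite ltnn.
Qed.

End Exchange.

(** [exchange] holds in the fraction field of [L[s]]; multiplied by the differences of the variables
    it becomes an identity of polynomials. The entries of R are scalars of [L], so every [L]-linear
    functional may be applied to it. *)
Lemma exchange_poly (L : fieldType) r (z lam : 'I_n -> L) (j : 'I_n)
    (R : nat -> nat -> nat -> nat -> L) (v : 'I_n -> nat) :
  j != m ->
  (forall k l, R 0 0 k l = ((k == 0) && (l == 0))%:R) ->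
  (forall a b k l,
    R a.+1 b k l + R a b.+1 k l =
    (0 < k)%:R * R a b k.-1 l + (0 < l)%:R * R a b k l.-1) ->
  (forall a b k l,
    b%:R * R a.+1 b k l + (lam m - a%:R - (z m - z j)) * R a b.+1 k l =
    (0 < k)%:R * (lam j - l%:R) * R a b k.-1 l +
    (0 < l)%:R * (k%:R - (z m - z j)) * R a b k l.-1) ->
  let C t (c : {ffun 'I_r -> 'I_n}) : {mpoly L[r]} :=
    colour_poly (weight_factor (move_lt t) (fun i => (z i)%:MP) (fun i => (lam i)%:MP))
      (move_lt t) (fun l => 'X_l) c in
  \sum_(c : {ffun 'I_r -> 'I_n})
     ((agree_off m j (ncol c) v)%:R * R (ncol c m) (ncol c j) (v m) (v j)) *: C j c =
  \sum_(c : {ffun 'I_r -> 'I_n} | [forall k, ncol c k == v k]) C j.+1 c.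
Proof.
move=> jm R00 Rf Rfh C; pose B := {mpoly L[r]}; pose E := {fraction B}.
apply: (@tofrac_inj B).
pose io : {rmorphism L -> E} := @FracField.tofrac B \o @mpolyC r L.
pose s (l : 'I_r) : E := @FracField.tofrac B 'X_l.
have inj_s : injective s.
  move=> k l /tofrac_inj E1.
  have := congr1 (mcoeff U_(k)) E1; rewrite !mcoeffXU eqxx.
  by case: (eqVneq l k) => // _ /eqP; rewrite oner_eq0.
pose w t := weight_factor (move_lt t) (io \o z) (io \o lam).
have CE t c : @FracField.tofrac B (C t c) =
    (\prod_(k < r) \prod_(l < r | (k < l)%N) (s l - s k)) *
    colour_frac (w t) (move_lt t) s c.
  rewrite -colour_poly_frac //; last 2 first.
  - exact: move_ltxx.
  - exact: move_lt_asym.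
  by rewrite (rmorph_colour_poly (wB := w t)) // => k y; rewrite rmorph_weight_factor.
rewrite !rmorph_sum /=; under [RHS]eq_bigr => c _ do rewrite CE.
rewrite -mulr_sumr.
pose w0 k := if k is Some k then w j k else move_weight (io \o z) (io \o lam) j.
rewrite -(@exchange _ r E s inj_s (w j) (w j.+1) (move_lt j) (move_lt j.+1) m j
  (io (z m)) (io (z j)) (io (lam m)) (io (lam j)) w0 (move_lt0 j)
  _ _ _ _ _ _ _ _ _ _ _ (fun a b k l => io (R a b k l))); first last.
- move=> a b k l; have := congr1 io (Rfh a b k l).
  by rewrite !(rmorphD io, rmorphM io, rmorphN io, rmorph_nat io).
- by move=> a b k l; rewrite -rmorphD Rf rmorphD !rmorphM !rmorph_nat.
- by move=> k l; rewrite R00 rmorph_nat.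
- by move=> k l kl; rewrite move_ltS_other // move_ltE.
- by move=> k l kl; rewrite move_ltE.
- by rewrite /move_lt !eqxx (negPf jm) !ltnn !leqnn.
- by rewrite /move_lt !eqxx (negPf jm) !ltnn !leqnn.
- by move=> k y km kj; rewrite /w weight_factor_move_other.
- by [].
- by move=> y; rewrite /w weight_factor_moved_j.
- by move=> y; rewrite /w weight_factor_moved_m //= opprB addrA addrAC.
- by move=> y; rewrite /w weight_factor_move_j //= opprB addrA addrAC.
- by move=> y; rewrite /w weight_factor_move_m.
- by rewrite eq_sym.
rewrite mulr_sumr; apply: eq_bigr => c _.
rewrite -mul_mpolyC rmorphM /= CE -/(io _) rmorphM rmorph_nat; ring.
Qed.

End MovingColour.

(** * The action of e *)

Lemma telescope_prod (B : comPzRingType) n (a b : 'I_n -> B) :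
  \prod_i a i - \prod_i b i =
  \sum_(i < n) (\prod_(k < n | (k < i)%N) a k) * (a i - b i) *
    \prod_(k < n | (i < k)%N) b k.
Proof.
elim: n a b => [|n IH] a b; first by rewrite !big_ord0 subrr.
pose wd := widen_ord (leqnSn n).
have lt_prod (i : nat) : (i <= n)%N ->
    \prod_(k < n.+1 | (k < i)%N) a k = \prod_(k < n | (k < i)%N) a (wd k).
  move=> lein; rewrite big_mkcond big_ord_recr /= ltnNge lein mulr1.
  by rewrite -big_mkcond.
have gt_prod (i : 'I_n) : \prod_(k < n.+1 | (i < k)%N) b k =
    (\prod_(k < n | (i < k)%N) b (wd k)) * b ord_max.
  by rewrite big_mkcond big_ord_recr /= ltn_ord -big_mkcond.
rewrite !big_ord_recr lt_prod //= [X in _ = _ + _ * X]big_pred0 => [|k]; last first.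
  by rewrite ltnNge -ltnS ltn_ord.
rewrite [X in _ = _ + X * _ * _](eq_bigl predT) => [|k]; last by rewrite /= ltn_ord.
rewrite mulr1 [X in _ = X + _](_ : _ = (\prod_(k < n) a (wd k) -
  \prod_(k < n) b (wd k)) * b ord_max); first by ring.
rewrite IH mulr_suml; apply: eq_bigr => i _.
by rewrite lt_prod ?(ltnW (ltn_ord i)) // gt_prod mulrA.
Qed.

Section Marked.
Variables (n r : nat).

Definition marked_weight (B : pzRingType) (w : 'I_n -> B -> B) (w0 : B -> B)
  (k : option 'I_n) : B -> B := if k is Some k then w k else w0.

Definition lt_first : rel (option 'I_n) := fun k l =>
  match k, l with
  | None, l => l != None
  | _, None => false
  | Some k, Some l => (k < l)%N
  end.

Definition lt_last : rel (option 'I_n) := fun k l =>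
  match k, l with
  | None, _ => false
  | Some _, None => true
  | Some k, Some l => (k < l)%N
  end.

(* The variable s_j is taken out of the colouring and coloured None, which
   comes before (lt_first) or after (lt_last) all the tensor factors. *)
Definition mark (j : 'I_r.+1) (c : 'I_r -> 'I_n) : {ffun 'I_r.+1 -> option 'I_n} :=
  insert j None (Some \o c).

Section Fractions.
Variables (E : fieldType) (s : 'I_r.+1 -> E) (x lam : 'I_n -> E).
Hypothesis inj_s : injective s.
Let w := weight_factor (@ord_lt n) x lam.
Let first := colour_frac (marked_weight w (fun y => \prod_k (y - x k))) lt_first s.
Let last := colour_frac (marked_weight w (fun y => \prod_k (y - x k + lam k))) lt_last s.

(** The effect of carrying [s j] across the tensor factor [i]: its factors with this site and with
    the variables of colour [i] when it comes after them, minus those when it comes before. *)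
Definition site_diff (i : 'I_n) (X : {set 'I_r.+1}) (j : 'I_r.+1) : E :=
  (s j - x i + lam i) * pfcoef s (-1) X j - (s j - x i) * pfcoef s 1 X j.

(** The marked variable passes from the first place to the last by crossing the tensor factors one
    at a time. The product telescopes accordingly, and the crossing of factor [i] leaves the weight
    that [s j] has when coloured [i]. *)
Lemma mark_diff j (c : {ffun 'I_r -> 'I_n}) :
  last (mark j c) - first (mark j c) =
  \sum_i colour_frac w (@ord_lt n) s (insert j i c) *
    site_diff i [set k | insert j i c k == i] j.
Proof.
set X := colour_frac w (@ord_lt n) (s \o fintype.lift j) c.
pose P i := \prod_(k | c k == i) (1 + 1 / (s j - s (fintype.lift j k))).
pose N i := \prod_(k | c k == i) (1 + 1 / (s (fintype.lift j k) - s j)).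
have prodE (f : 'I_r -> E) (Q : pred 'I_n) :
    \prod_(k | Q (c k)) f k = \prod_(i | Q i) \prod_(k | c k == i) f k.
  rewrite (partition_big c Q) //=; apply: eq_bigr => i Qi; apply: eq_bigl => k.
  by case: eqVneq => [->|]; rewrite ?Qi ?andbF.
have -> : first (mark j c) = X * \prod_i ((s j - x i) * P i).
  rewrite /first colour_frac_insert // [X in _ * (_ * X)]big_pred0 // mulr1.
  congr (_ * _); rewrite big_split /=; congr (_ * _).
  by rewrite (prodE _ predT).
have -> : last (mark j c) = X * \prod_i ((s j - x i + lam i) * N i).
  rewrite /last colour_frac_insert // [X in _ * (_ * X * _)]big_pred0 // mulr1.
  congr (_ * _); rewrite big_split /=; congr (_ * _).
  by rewrite (prodE _ predT).
rewrite -mulrBr telescope_prod mulr_sumr; apply: eq_bigr => i _.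
rewrite colour_frac_insert; last by rewrite /ord_lt ltnn.
rewrite -/X -[RHS]mulrA; congr (_ * _).
have pf e : pfcoef s e [set k | insert j i c k == i] j =
    \prod_(k | c k == i) (1 + e / (s j - s (fintype.lift j k))).
  rewrite /pfcoef big_mkcond (bigD1_ord j) //= eqxx andbF mul1r [RHS]big_mkcond.
  apply: eq_bigr => k _; rewrite !inE insert_lift (eq_sym (fintype.lift j k)).
  by rewrite neq_lift andbT.
have -> : site_diff i [set k | insert j i c k == i] j =
    (s j - x i + lam i) * N i - (s j - x i) * P i.
  rewrite /site_diff !pf; congr (_ * _ - _); apply: eq_bigr => k _.
  by rewrite -[s j - _]opprB invrN mulrNN.
rewrite !big_split /= (prodE _ (fun k => ord_lt i k)) (prodE _ (fun k => ord_lt k i)).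
rewrite /w /weight_factor -!/(N _) -!/(P _); rewrite /ord_lt /=; ring.
Qed.

(** The right side is the matrix coefficient [k (Lam - k + 1)] of e, with [k = #|X|]. The sums of
    the [s j] cancel between the signs [e = -1] and [e = 1], and the two binomial terms add up to
    [- k (k - 1)]. *)
Lemma sum_site_diff i (X : {set 'I_r.+1}) :
  \sum_(j in X) site_diff i X j = #|X|%:R * (lam i - #|X|.-1%:R).
Proof.
rewrite sumrB.
have sumE e ga : \sum_(j in X) (s j + ga) * pfcoef s e X j =
    \sum_(j in X) s j + e * 'C(#|X|, 2)%:R + ga * #|X|%:R.
  rewrite -(sum_mul_pfcoef e inj_s) -(sum_pfcoef e inj_s) mulr_sumr -big_split /=.
  by apply: eq_bigr => j _; rewrite mulrDl.
rewrite (eq_bigr (fun j => (s j + (lam i - x i)) * pfcoef s (-1) X j)); last first.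
  by move=> j _; congr (_ * _); ring.
rewrite !sumE.
have bin2E : #|X|%:R * #|X|.-1%:R = 2%:R * 'C(#|X|, 2)%:R :> E.
  by rewrite -!natrM -mul_bin_diag bin1.
by rewrite mulrBr bin2E; ring.
Qed.

(** The right side is the coordinate [u] of e applied to the weight function in [r.+1] variables: to
    reach [u], e lowers one extra variable of colour [i]. *)
Lemma sum_mark_diff (u : 'I_n -> nat) :
  \sum_j \sum_(c : {ffun 'I_r -> 'I_n} | [forall k, ncol c k == u k])
     (last (mark j c) - first (mark j c)) =
  \sum_i (u i).+1%:R * (lam i - (u i)%:R) *
    \sum_(c : {ffun 'I_r.+1 -> 'I_n} | [forall k, ncol c k == ((i == k) + u k)%N])
      colour_frac w (@ord_lt n) s c.
Proof.
transitivity (\sum_i \sum_j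
    \sum_(c : {ffun 'I_r -> 'I_n} | [forall k, ncol c k == u k])
      colour_frac w (@ord_lt n) s (insert j i c) *
      site_diff i [set k | insert j i c k == i] j).
  rewrite [RHS]exchange_big; apply: eq_bigr => j _.
  rewrite [RHS]exchange_big; apply: eq_bigr => c _; exact: mark_diff.
apply: eq_bigr => i _.
transitivity (\sum_j \sum_(c : {ffun 'I_r.+1 -> 'I_n} |
      [forall k, ncol c k == ((i == k) + u k)%N] && (c j == i))
      colour_frac w (@ord_lt n) s c * site_diff i [set k | c k == i] j).
  apply: eq_bigr => j _; rewrite sum_insert; apply: eq_bigl => c.
  by apply: eq_forallb => k; rewrite ncol_insert eqn_add2l.
rewrite (exchange_big_dep
  (fun c : {ffun 'I_r.+1 -> 'I_n} => [forall k, ncol c k == ((i == k) + u k)%N])) /=;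
  last by move=> j c _ /andP[].
rewrite mulr_sumr; apply: eq_bigr => c cu.
have cardi : #|[set k | c k == i]| = (u i).+1.
  by have /forallP/(_ i)/eqP := cu; rewrite /ncol eqxx.
rewrite -mulr_sumr mulrC; congr (_ * _).
have := sum_site_diff i [set k | c k == i]; rewrite cardi /= => <-.
by apply: eq_bigl => j; rewrite cu inE.
Qed.

End Fractions.

Lemma sum_mark_poly (L : fieldType) (x lam : 'I_n -> L) (u : 'I_n -> nat) :
  let xB i : {mpoly L[r.+1]} := (x i)%:MP in
  let lB i : {mpoly L[r.+1]} := (lam i)%:MP in
  let w := weight_factor (@ord_lt n) xB lB in
  let s (j : 'I_r.+1) : {mpoly L[r.+1]} := 'X_j in
  \sum_j \sum_(c : {ffun 'I_r -> 'I_n} | [forall k, ncol c k == u k])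
     (colour_poly (marked_weight w (fun y => \prod_k (y - xB k + lB k)))
        lt_last s (mark j c) -
      colour_poly (marked_weight w (fun y => \prod_k (y - xB k)))
        lt_first s (mark j c)) =
  \sum_i ((u i).+1%:R * (lam i - (u i)%:R)) *:
    \sum_(c : {ffun 'I_r.+1 -> 'I_n} | [forall k, ncol c k == ((i == k) + u k)%N])
      colour_poly w (@ord_lt n) s c.
Proof.
move=> xB lB w s; pose B := {mpoly L[r.+1]}; pose E := {fraction B}.
apply: (@tofrac_inj B); pose tf := @FracField.tofrac B.
pose sE j : E := tf (s j).
have inj_s : injective sE.
  move=> k l /tofrac_inj E1.
  have := congr1 (mcoeff U_(k)) E1; rewrite !mcoeffXU eqxx.
  by case: (eqVneq l k) => // _ /eqP; rewrite oner_eq0.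
set D := \prod_(k < r.+1) \prod_(l < r.+1 | (k < l)%N) (sE l - sE k).
have wE k y : tf (w k y) = weight_factor (@ord_lt n) (tf \o xB) (tf \o lB) k (tf y).
  by rewrite /tf rmorph_weight_factor.
rewrite !rmorph_sum /=.
transitivity (D * \sum_j \sum_(c : {ffun 'I_r -> 'I_n} | [forall k, ncol c k == u k])
  (colour_frac (marked_weight (weight_factor (@ord_lt n) (tf \o xB) (tf \o lB))
      (fun y => \prod_k (y - tf (xB k) + tf (lB k)))) lt_last sE (mark j c) -
   colour_frac (marked_weight (weight_factor (@ord_lt n) (tf \o xB) (tf \o lB))
      (fun y => \prod_k (y - tf (xB k)))) lt_first sE (mark j c))).
  rewrite mulr_sumr; apply: eq_bigr => j _; rewrite rmorph_sum mulr_sumr.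
  apply: eq_bigr => c _; rewrite rmorphB mulrBr.
  rewrite -!(colour_poly_frac _ _ inj_s) //; last 4 first.
  - by case=> //= k; rewrite ltnn.
  - by move=> [k|] [l|] //=; rewrite -leqNgt => /ltnW.
  - by case=> //= k; rewrite ltnn.
  - by move=> [k|] [l|] //=; rewrite -leqNgt => /ltnW.
  congr (_ - _); apply: rmorph_colour_poly => -[k|] y /=; rewrite ?wE //.
    by rewrite rmorph_prod; apply: eq_bigr => k _; rewrite rmorphD rmorphB.
  by rewrite rmorph_prod; apply: eq_bigr => k _; rewrite rmorphB.
rewrite (sum_mark_diff _ _ inj_s) mulr_sumr; apply: eq_bigr => i _.
rewrite -mul_mpolyC rmorphM /= rmorph_sum mulrCA !mulr_sumr.
apply: eq_bigr => c _; rewrite (rmorph_colour_poly _ _ _ wE).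
rewrite (colour_poly_frac _ _ inj_s); last 2 first.
- by move=> k; rewrite /ord_lt ltnn.
- by move=> k l; rewrite /ord_lt -leqNgt => /ltnW.
by rewrite mpolyCM rmorphM mpolyCB rmorphB /= !mpolyC_nat !rmorph_nat.
Qed.

End Marked.

(** * The coefficients of W F as vectors *)

Lemma freeg_ind (R : nzRingType) (M : choiceType) (P : {freeg M / R} -> Prop) :
  P 0 -> (forall c m, P << c *g m >>) -> (forall u v, P u -> P v -> P (u + v)) ->
  forall v, P v.
Proof.
move=> P0 PU PD v; rewrite -(freeg_sumE v); elim/big_ind: _ => // m _; exact: PU.
Qed.

Lemma fgliftD (R : nzRingType) (M : choiceType) (V : lmodType R) (F : M -> V) u v :
  fglift F (u + v) = fglift F u + fglift F v.
Proof.
pose f := GRing.isZmodMorphism.Build _ _ (fglift F) (@lift_is_additive _ _ V F).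
pose g : {additive {freeg M / R} -> V} := HB.pack (fglift F) f.
exact: (raddfD g).
Qed.

Lemma fglift0 (R : nzRingType) (M : choiceType) (V : lmodType R) (F : M -> V) :
  fglift F 0 = 0.
Proof. by apply: (addIr (fglift F 0)); rewrite -fgliftD !add0r. Qed.

Lemma fglift_sum (R : nzRingType) (M : choiceType) (V : lmodType R) (F : M -> V)
    (I : Type) (s : seq I) (P : pred I) (G : I -> {freeg M / R}) :
  fglift F (\sum_(i <- s | P i) G i) = \sum_(i <- s | P i) fglift F (G i).
Proof. by apply: big_morph; [exact: fgliftD | exact: fglift0]. Qed.

Lemma coeff_f_at (B : comNzRingType) n (i : 'I_n) (v : tens B n) (w : 'X_{1..n}) :
  coeff w (f_at i v) = (0 < w i)%:R * coeff (w - U_(i))%MM v.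
Proof.
elim/freeg_ind: v => [|c m|u v IHu IHv].
- by rewrite /f_at fglift0 !coeff0 mulr0.
- rewrite f_atU !coeffU mulrCA -natrM mulnb; congr (_ * (nat_of_bool _)%:R).
  apply/eqP/andP => [<-|[wi /eqP ->]].
    by rewrite mnmDE mnm1E eqxx addn1 addmK.
  by rewrite submK // lep1mP -lt0n.
by rewrite /f_at fgliftD !coeffD IHu IHv mulrDr.
Qed.

Lemma coeff_e_at (B : comNzRingType) n (lam : 'I_n -> B) (i : 'I_n) (v : tens B n)
    (w : 'X_{1..n}) :
  coeff w (e_at lam i v) =
  (w i).+1%:R * (lam i - (w i)%:R) * coeff (w + U_(i))%MM v.
Proof.
elim/freeg_ind: v => [|c m|u v IHu IHv].
- by rewrite /e_at fglift0 !coeff0 mulr0.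
- rewrite e_atU !coeffU; have [->|mw] := eqVneq m (w + U_(i))%MM.
    by rewrite addmK !eqxx mnmDE mnm1E eqxx addn1 -natr1 /=; ring.
  have [mi|mi] := eqVneq (m i) 0%N; first by rewrite mi /=; ring.
  case: eqP => [mw'|_]; last by rewrite !mulr0.
  by case/eqP: mw; rewrite -mw' submK ?lep1mP.
have -> : e_at lam i (u + v) = e_at lam i u + e_at lam i v by exact: fgliftD.
by rewrite !coeffD IHu IHv -mulrDr.
Qed.

Section Solution.
Variables (p : nat) (L : fieldType) (n r' : nat) (a : 'F_p) (Lam : 'I_n -> 'F_p).
Local Notation r := r'.+1.
Hypothesis pr_p : prime p.
Hypothesis p0 : p%:R = 0 :> L.
Hypothesis a0 : a != 0.
Variable (k : 'X_{1..r}).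
Hypothesis k_last : forall j, (k j).+1%:R = 0 :> L.
Local Notation B := {mpoly L[r]}.
Local Notation aL := (of_Fp L a).
Local Notation lam := (fun i => of_Fp L (Lam i)).

Let s (j : 'I_r) : B := 'X_j.
Let cst_pt (z : 'I_n -> L) (i : 'I_n) : B := (z i)%:MP.

Definition master_rest (z : 'I_n -> L) : B :=
  (\prod_j master_site a Lam (cst_pt z) (s j)) * master_pairs a s.

Definition colour_term (lt : rel 'I_n) (z : 'I_n -> L) (c : 'I_r -> 'I_n) : B :=
  colour_poly (weight_factor lt (cst_pt z) (cst_pt lam)) lt s c.

Definition colour_mnm (c : 'I_r -> 'I_n) : 'X_{1..n} := [multinom ncol c i | i < n].

(** The order and the point are both free: the factors of [qKZ] pass through other orders of the
    tensor factors, and the cyclic step changes the point. *)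
Definition solution (lt : rel 'I_n) (z : 'I_n -> L) : tens L n :=
  \sum_(c : {ffun 'I_r -> 'I_n})
    << newton aL k (colour_term lt z c * master_rest z) *g colour_mnm c >>.

Lemma colour_mnmE (c : 'I_r -> 'I_n) (u : 'X_{1..n}) :
  (colour_mnm c == u) = [forall i, ncol c i == u i].
Proof.
apply/eqP/forallP => [<- i|cu]; first by rewrite mnmE.
by apply/mnmP => i; rewrite mnmE; apply/eqP.
Qed.

Lemma coeff_solution lt z (u : 'X_{1..n}) :
  coeff u (solution lt z) =
  newton aL k ((\sum_(c : {ffun 'I_r -> 'I_n} | [forall i, ncol c i == u i])
     colour_term lt z c) * master_rest z).
Proof.
rewrite /solution raddf_sum mulr_suml [RHS]raddf_sum [RHS]big_mkcond /=.
apply: eq_bigr => c _; by rewrite coeffU colour_mnmE mulr_natr mulrb.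
Qed.

Lemma coeff_solution_weight (W : 'X_{1..n} -> {mpoly int[r + n + n]}) z (u : 'X_{1..n}) :
  is_weight W -> mdeg u = r ->
  coeff u (solution (@ord_lt n) z) =
  newton aL k (int_eval s (cst_pt z) (cst_pt lam) (W u) * master a Lam s (cst_pt z)).
Proof.
move=> hW ur; rewrite coeff_solution; apply: (congr1 (newton aL k)).
rewrite masterE [RHS]mulrCA [RHS]mulrA; apply: (congr2 *%R); last by [].
exact/esym/weight_polynomial.
Qed.

Lemma eq_solution lt lt' z z' : lt =2 lt' -> z =1 z' -> solution lt z = solution lt' z'.
Proof.
move=> eqlt eqz; apply: eq_bigr => c _; congr << newton _ _ _ *g _ >>.
have eqc i : cst_pt z i = cst_pt z' i by rewrite /cst_pt eqz.
congr (_ * _); last first.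
  congr (_ * _); apply: eq_bigr => j _; apply: eq_bigr => i _.
  by rewrite eqc.
apply: eq_colour_poly => // i y; congr (_ * _).
  by apply: eq_big => [l|l _]; rewrite ?eqlt ?eqc.
by apply: eq_big => [l|l _]; rewrite ?eqlt ?eqc.
Qed.

Lemma pB0 : p%:R = 0 :> B.
Proof. by rewrite -mpolyC_nat p0 mpolyC0. Qed.

Lemma cst_of_Fp (b : 'F_p) : (of_Fp L b)%:MP = of_Fp B b.
Proof. exact: (rmorph_of_Fp (@mpolyC r L)). Qed.

Lemma site_shift (y : B) b :
  y * gpoly a y b = (y - of_Fp B a + of_Fp B b) * gpoly a (y - of_Fp B a) b.
Proof.
by rewrite -(gpoly_shift pr_p pB0 a0 (y - of_Fp B a)) subrK.
Qed.

Lemma newton_shift (S : {set 'I_r}) f : newton aL k (shift_set aL S f) = newton aL k f.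
Proof. by apply: newton_shift_set => j; rewrite k_last mul0r. Qed.

Lemma shift_weight_factor S lt z i y :
  shift_set aL S (weight_factor lt (cst_pt z) (cst_pt lam) i y) =
  weight_factor lt (cst_pt z) (cst_pt lam) i (shift_set aL S y).
Proof.
rewrite rmorph_weight_factor; congr (_ * _); apply: eq_bigr => l _ /=.
  by rewrite !shift_setC.
by rewrite shift_setC.
Qed.

Lemma shift_master_site S z y :
  shift_set aL S (master_site a Lam (cst_pt z) y) =
  master_site a Lam (cst_pt z) (shift_set aL S y).
Proof.
by rewrite rmorph_master_site; apply: eq_bigr => l _ /=; rewrite shift_setC.
Qed.

(** The identity holds colouring by colouring: the variables to be shifted are those of colour [m],
    a set that depends on [c], and [newton] ignores the shift for every such set. *)
Lemma solution_cyclic (m : 'I_n) (z : 'I_n -> L) :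
  solution (move_lt m n) z =
  solution (move_lt m 0) (fun i => if i == m then z i + aL else z i).
Proof.
set z' := fun i => _; apply: eq_bigr => c _; congr << _ *g _ >>.
rewrite -(newton_shift [set j | c j == m]); congr newton; apply/esym.
have z'm : cst_pt z' m = cst_pt z m + of_Fp B a.
  by rewrite /cst_pt /z' eqxx mpolyCD cst_of_Fp.
have z'i i : i != m -> cst_pt z' i = cst_pt z i.
  by rewrite /cst_pt /z' => /negPf ->.
apply: (colour_shift pr_p pB0 a0 (mc := m)).
- split=> [i im|i|i im|i|i l im lm]; rewrite /move_lt ?eqxx ?(negPf im) ?(negPf lm) //.
  + by rewrite leqNgt ltn_ord andbF.
  + by case: (eqVneq i m).
(* A variable of another colour stays while [z m] moves. Its factor [y - z m] for the order with [m]
   last becomes [y - z' m + lam m] for [m] first, and [site_shift] balances this with the master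
   function. *)
- move=> i y im; rewrite /weight_factor /master_site !(bigD1 m (P := predT)) //=.
  rewrite (bigD1 m) /=; last by rewrite /move_lt eqxx im.
  rewrite [in RHS](bigD1 m (P := fun l => move_lt m n i l)) /=; last first.
    by rewrite /move_lt (negPf im) eqxx ltn_ord.
  rewrite z'm opprD addrA /(cst_pt lam m) cst_of_Fp.
  have := site_shift (y - cst_pt z m) (Lam m).
  set G1 := gpoly a (y - cst_pt z m) _; set G2 := gpoly a _ (Lam m) => GE.
  rewrite (eq_bigr (fun l => y - cst_pt z l + cst_pt lam l)) => [|l /andP[_ lm]];
    last by rewrite z'i.
  rewrite [X in _ * X * _ = _](eq_bigr (fun l => y - cst_pt z l)) => [|l]; last first.
    rewrite /move_lt (negPf im); case: (eqVneq l m) => // lm _; by rewrite z'i.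
  rewrite [X in _ * (_ * X) = _](eq_bigr (fun l => gpoly a (y - cst_pt z l) (Lam l)));
    last by move=> l lm; rewrite z'i.
  rewrite [X in _ = X * _ * _](eq_bigl (fun l => move_lt m 0 l i && (l != m))); last first.
    move=> l; rewrite /move_lt (negPf im); case: (eqVneq l m) => [_|lm].
      by rewrite leqNgt ltn_ord !andbF.
    by rewrite andbT.
  rewrite [X in _ = _ * (_ * X) * _](eq_bigl (fun l => move_lt m 0 i l)); last first.
    move=> l; rewrite /move_lt (negPf im); case: (eqVneq l m) => [_|lm].
      by rewrite andbF.
    by rewrite andbT.
  set X1 := \prod_(l | _) (_ + _); set X2 := \prod_(l | _) _; set X3 := \prod_(l | _) _.
  rewrite [LHS](_ : _ =
    X1 * X2 * X3 * ((y - cst_pt z m - of_Fp B a + of_Fp B (Lam m)) * G2)); last by ring.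
  by rewrite -GE; ring.
- move=> y; rewrite /weight_factor /master_site.
  rewrite big_pred0 => [|l]; last first.
    by rewrite /move_lt; case: (eqVneq l m) => //; rewrite eqxx.
  rewrite [X in _ = _ * X * _]big_pred0 => [|l]; last first.
    by rewrite /move_lt eqxx leqNgt ltn_ord andbF.
  rewrite mul1r mulr1 !(bigD1 m (P := predT)) //= mulrCA [RHS]mulrCA; congr (_ * _).
    by rewrite z'm; congr gpoly; ring.
  rewrite (eq_bigl (fun l => l != m)) => [|l]; last by rewrite /move_lt eqxx andbT.
  rewrite [in RHS](eq_bigl (fun l => l != m)) => [|l]; last first.
    by rewrite /move_lt eqxx; case: (eqVneq l m) => //=; rewrite ltn_ord.
  rewrite -!big_split; apply: eq_bigr => l lm /=.
  rewrite z'i // site_shift /cst_pt cst_of_Fp; congr (_ * gpoly a _ _); ring.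
- by move=> j; rewrite /s /= shift_setX inE cst_of_Fp; case: (c j == m).
- by move=> i y; apply: shift_weight_factor.
- by move=> y; apply: shift_master_site.
Qed.

(** The colour [None] has no site of its own, so shifting the marked variable moves it from last to
    first without changing the point [z]. *)
Lemma newton_mark z (j : 'I_r) (c : 'I_r' -> 'I_n) :
  let w := weight_factor (@ord_lt n) (cst_pt z) (cst_pt lam) in
  newton aL k (colour_poly
    (marked_weight w (fun y => \prod_i (y - cst_pt z i + cst_pt lam i)))
    (@lt_last n) s (mark j c) * master_rest z) =
  newton aL k (colour_poly (marked_weight w (fun y => \prod_i (y - cst_pt z i)))
    (@lt_first n) s (mark j c) * master_rest z).
Proof.
move=> w; apply: (etrans (esym (newton_shift [set l | mark j c l == None] _))).
apply: (congr1 (newton aL k)); apply/esym.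
apply: (colour_shift pr_p pB0 a0 (mc := None)).
- by split=> [[i|]|i|[i|]|[i|]|[i|] [l|]].
- by case.
- move=> y /=; rewrite /master_site -!big_split; apply: eq_bigr => i _ /=.
  rewrite site_shift /cst_pt cst_of_Fp; congr (_ * gpoly a _ _); ring.
- by move=> l; rewrite /s /= shift_setX inE cst_of_Fp; case: (mark j c l == None).
- move=> [i|] y; first by apply: shift_weight_factor.
  rewrite rmorph_prod; apply: eq_bigr => i _ /=.
  by rewrite rmorphD rmorphB /= !shift_setC.
- by move=> y; apply: shift_master_site.
Qed.

Lemma solution_singular z : e_diag lam (solution (@ord_lt n) z) = 0.
Proof.
apply/eqP/freeg_eqP => u; rewrite coeff0 /e_diag raddf_sum /=.
under eq_bigr => i _ do rewrite coeff_e_at coeff_solution -newtonZ scalerAl.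
rewrite -raddf_sum -mulr_suml /=.
rewrite (eq_bigr (fun i => ((u i).+1%:R * (lam i - (u i)%:R)) *:
    \sum_(c : {ffun 'I_r -> 'I_n} | [forall k, ncol c k == ((i == k) + u k)%N])
      colour_term (@ord_lt n) z c)); last first.
  move=> i _; congr (_ *: _); apply: eq_bigl => c; apply: eq_forallb => l.
  by rewrite mnmDE mnm1E addnC.
rewrite -(sum_mark_poly r' z lam u) mulr_suml raddf_sum big1 // => j _.
rewrite mulr_suml raddf_sum big1 // => c _.
rewrite mulrBl raddfB; apply/eqP; rewrite subr_eq0; apply/eqP.
exact: newton_mark.
Qed.

End Solution.

(** * Specialization of the R-matrix *)

Lemma fraction_rep (A : idomainType) (g : {fraction A}) :
  exists P D : A, D != 0 /\ g = FracField.tofrac P / FracField.tofrac D.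
Proof.
exists \n_(repr g), \d_(repr g); have d0 := denom_ratioP (repr g); split=> //.
have d0' : FracField.tofrac \d_(repr g) != 0 by rewrite tofrac_eq0.
apply: (canRL (mulfK d0')).
move: (repr g) d0 (reprK g) {d0'} => f f0 <-; rewrite !piE.
apply/eqmodP; rewrite /= FracField.equivfE /FracField.mulf.
by rewrite !numden_Ratio ?mulr1 ?mul1r ?oner_eq0 // mulrC.
Qed.

Section RatfunEval.
Variables (K L : fieldType) (iota : {rmorphism K -> L}) (y : L).
Hypothesis y_tr : forall q : {poly K}, q != 0 -> (map_poly iota q).[y] != 0.
Local Notation psi := (fun g => ratfun_eval iota g y).

Lemma ratfun_eval_poly (P : {poly K}) :
  psi (FracField.tofrac P) = (map_poly iota P).[y].
Proof.
rewrite -[FracField.tofrac P]divr1 -tofrac1 ratfun_evalE ?oner_eq0 //.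
by rewrite rmorph1 hornerC divr1.
Qed.

Lemma ratfun_eval_is_zmod_morphism : zmod_morphism psi.
Proof.
move=> g h; have [P [D [D0 ->]]] := fraction_rep g.
have [P' [D' [D'0 ->]]] := fraction_rep h.
rewrite -mulNr addf_div ?tofrac_eq0 // -tofracN -!tofracM -tofracD.
rewrite !ratfun_evalE ?mulf_neq0 // -mulNr addf_div ?y_tr //.
by rewrite rmorphD !rmorphM rmorphN hornerD !hornerM hornerN.
Qed.

Lemma ratfun_eval_is_monoid_morphism : monoid_morphism psi.
Proof.
split=> [|g h]; first by rewrite -tofrac1 ratfun_eval_poly rmorph1 hornerC.
have [P [D [D0 ->]]] := fraction_rep g; have [P' [D' [D'0 ->]]] := fraction_rep h.
rewrite mulf_div -!tofracM !ratfun_evalE ?mulf_neq0 // mulf_div.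
by rewrite !rmorphM !hornerM.
Qed.

Definition ratfun_eval_rmorph : {rmorphism {fraction {poly K}} -> L} :=
  HB.pack psi
    (GRing.isZmodMorphism.Build _ _ psi ratfun_eval_is_zmod_morphism)
    (GRing.isMonoidMorphism.Build _ _ psi ratfun_eval_is_monoid_morphism).

End RatfunEval.

Lemma pair_idx0 k l : pair_idx k l ord0 = k.
Proof. by rewrite mnmE. Qed.

Lemma pair_idx1 k l : pair_idx k l ord_max = l.
Proof. by rewrite mnmE. Qed.

Lemma ord2P (i : 'I_2) : i = ord0 \/ i = ord_max.
Proof. by case: i => [[|[|//]] lti]; [left | right]; apply: val_inj. Qed.

Lemma pair_idxE (w : 'X_{1..2}) : w = pair_idx (w ord0) (w ord_max).
Proof. by apply/mnmP => i; case: (ord2P i) => ->; rewrite ?pair_idx0 ?pair_idx1. Qed.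

Lemma pair_idxD0 k l : (pair_idx k l + U_(ord0))%MM = pair_idx k.+1 l.
Proof.
by apply/mnmP => i; case: (ord2P i) => ->;
  rewrite mnmDE mnm1E ?pair_idx0 ?pair_idx1 /= ?addn0 ?addn1.
Qed.

Lemma pair_idxD1 k l : (pair_idx k l + U_(ord_max))%MM = pair_idx k l.+1.
Proof.
by apply/mnmP => i; case: (ord2P i) => ->;
  rewrite mnmDE mnm1E ?pair_idx0 ?pair_idx1 /= ?addn0 ?addn1.
Qed.

Lemma pair_idxB0 k l : (pair_idx k l - U_(ord0))%MM = pair_idx k.-1 l.
Proof.
by apply/mnmP => i; case: (ord2P i) => ->;
  rewrite mnmBE mnm1E ?pair_idx0 ?pair_idx1 /= ?subn0 ?subn1.
Qed.

Lemma pair_idxB1 k l : (pair_idx k l - U_(ord_max))%MM = pair_idx k l.-1.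
Proof.
by apply/mnmP => i; case: (ord2P i) => ->;
  rewrite mnmBE mnm1E ?pair_idx0 ?pair_idx1 /= ?subn0 ?subn1.
Qed.

Lemma coeff_h1_at (B : comNzRingType) n (lam : 'I_n -> B) i (v : tens B n) w :
  coeff w (h1_at lam i v) = (lam i - (w i)%:R) * coeff w v.
Proof.
elim/freeg_ind: v => [|c m|u v IHu IHv].
- by rewrite /h1_at fglift0 !coeff0 mulr0.
- rewrite h1_atU !coeffU; case: eqP => [->|_]; last by rewrite !mulr0.
  by rewrite !mulr1 mulrC.
have -> : h1_at lam i (u + v) = h1_at lam i u + h1_at lam i v by exact: fgliftD.
by rewrite !coeffD IHu IHv -mulrDr.
Qed.

Lemma coeff_h2_at (B : comNzRingType) n i (v : tens B n) w :
  coeff w (h2_at i v) = (w i)%:R * coeff w v.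
Proof.
elim/freeg_ind: v => [|c m|u v IHu IHv].
- by rewrite /h2_at fglift0 !coeff0 mulr0.
- rewrite h2_atU !coeffU; case: eqP => [->|_]; last by rewrite !mulr0.
  by rewrite !mulr1 mulrC.
have -> : h2_at i (u + v) = h2_at i u + h2_at i v by exact: fgliftD.
by rewrite !coeffD IHu IHv -mulrDr.
Qed.

Section RCoefficients.
Variables (K L : fieldType) (lam mu : K).
Local Notation Kx := {fraction {poly K}}.
Variable R : {linear tens Kx 2 -> tens Kx 2}.
Hypothesis hR : is_Rmatrix lam mu R.
Variable phi : {rmorphism Kx -> L}.

Definition Rcoef (a b k l : nat) : L := phi (coeff (pair_idx k l) (R << pair_idx a b >>)).

Let x := FracField.tofrac ('X : {poly K}).

Lemma Rcoef00 k l : Rcoef 0 0 k l = ((k == 0) && (l == 0))%:R.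
Proof.
case: hR => _ _ R0; rewrite /Rcoef.
have -> : pair_idx 0 0 = 0%MM by apply/mnmP => i; rewrite mnm0E mnmE; case: ifP.
rewrite R0 coeffU mul1r rmorph_nat; congr (nat_of_bool _)%:R.
apply/eqP/andP => [E1|[/eqP -> /eqP ->]].
  by rewrite -(pair_idx0 k l) -{2}(pair_idx1 k l) -E1 !mnm0E.
by apply/mnmP => i; rewrite mnm0E mnmE; case: ifP.
Qed.

Lemma Rcoef_f a b k l :
  Rcoef a.+1 b k l + Rcoef a b.+1 k l =
  (0 < k)%:R * Rcoef a b k.-1 l + (0 < l)%:R * Rcoef a b k l.-1.
Proof.
case: hR => Rf _ _; have := congr1 (coeff (pair_idx k l)) (Rf << pair_idx a b >>).
rewrite !f_atU pair_idxD0 pair_idxD1 linearD !coeffD !coeff_f_at.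
rewrite pair_idx0 pair_idx1 pair_idxB0 pair_idxB1 => /(congr1 phi).
by rewrite !rmorphD !rmorphM !rmorph_nat.
Qed.

Lemma Rcoef_fh a b k l :
  b%:R * Rcoef a.+1 b k l +
    (phi (FracField.tofrac lam%:P) - a%:R - phi x) * Rcoef a b.+1 k l =
  (0 < k)%:R * (phi (FracField.tofrac mu%:P) - l%:R) * Rcoef a b k.-1 l +
  (0 < l)%:R * (k%:R - phi x) * Rcoef a b k l.-1.
Proof.
case: hR => _ Rh _; have := congr1 (coeff (pair_idx k l)) (Rh << pair_idx a b >>).
set v := (X in R X); have -> : v = b%:R *: << pair_idx a.+1 b >> +
    (FracField.tofrac lam%:P - a%:R - x) *: << pair_idx a b.+1 >>.
  apply/eqP/freeg_eqP => w; rewrite /v h2_atU !f_atU h1_atU pair_idxD0 pair_idxD1.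
  rewrite !(coeffD, coeffN, coeffZ, coeffU) pair_idx0 pair_idx1 /= -/x. ring.
rewrite linearD !linearZ !(coeffD, coeffN, coeffZ) !coeff_f_at coeff_h1_at coeff_h2_at.
rewrite coeff_f_at pair_idxB0 pair_idxB1 !pair_idx0 !pair_idx1 /= -/x => /(congr1 phi).
rewrite !(rmorphD, rmorphM, rmorphN, rmorph_nat) -!/(Rcoef _ _ _ _) => ->.
by ring.
Qed.

End RCoefficients.

HB.instance Definition _ (K : fieldType) n := GRing.RMorphism.copy (@cst K n)
  (@FracField.tofrac {mpoly K[n]} \o @mpolyC n K).

Section RAction.
Variables (K : fieldType) (n : nat).
Local Notation L := {fraction {mpoly K[n]}}.

Definition transcendental (y : L) : Prop :=
  forall q : {poly K}, q != 0 -> (map_poly (@cst K n) q).[y] != 0.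

(** The substitution of [X - b] for [x_m] and of 0 for the other variables sends the point to [X],
    and hence the value of [q] to [q] itself. *)
Lemma transcendental_diff (m j : 'I_n) (b : K) : j != m ->
  transcendental (gen_pt K m - gen_pt K j + cst n b).
Proof.
move=> jm q q0; rewrite /gen_pt /cst -tofracB -tofracD.
set P := (X in FracField.tofrac X).
have -> : map_poly (@cst K n) q =
    map_poly (@FracField.tofrac {mpoly K[n]}) (map_poly (@mpolyC n K) q).
  by rewrite -map_poly_comp.
rewrite horner_map tofrac_eq0; apply: contraNneq q0 => qP0.
pose e : {rmorphism {mpoly K[n]} -> {poly K}} :=
  GRing.RMorphism.clone _ _
    (mmap (@polyC K) (fun i => if i == m then 'X - b%:P else 0)) _.
have eC (c : K) : e c%:MP = c%:P by rewrite /= mmapC.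
have eX i : e 'X_i = if i == m then 'X - b%:P else 0 by rewrite /= mmapX mmap1U.
have := congr1 e qP0; rewrite rmorph0 -horner_map -map_poly_comp.
have -> : e P = 'X by rewrite rmorphD rmorphB !eX eC eqxx (negPf jm) subr0 subrK.
rewrite (eq_map_poly (g := @polyC K)) => [|c]; last exact: eC.
by move=> q'0; rewrite -[q]comp_polyXr; apply/eqP; rewrite [_ \Po _]q'0.
Qed.

Variable R : 'I_n -> 'I_n ->
  {linear tens {fraction {poly K}} 2 -> tens {fraction {poly K}} 2}.

Lemma coeff_R_at (i j : 'I_n) (y : L) (y_tr : transcendental y) c (u v : 'X_{1..n}) :
  i != j ->
  coeff v (R_at R i j y << c *g u >>) =
  c * ((agree_off i j u v)%:R *
       Rcoef (R i j) (ratfun_eval_rmorph y_tr) (u i) (u j) (v i) (v j)).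
Proof.
move=> ij; rewrite /R_at liftU coeffZ; congr (_ * _).
set r := R i j _; rewrite raddf_sum /=; set w0 := pair_idx (v i) (v j).
rewrite [X in _ = _ * X](_ : _ = ratfun_eval_rmorph y_tr
  (coeff w0 (\sum_(w <- dom r) << coeff w r *g w >>))); last by rewrite freeg_sumE.
rewrite !raddf_sum mulr_sumr.
apply: eq_bigr => w _; rewrite coeffU.
transitivity ((agree_off i j u v)%:R *
  ratfun_eval_rmorph y_tr (coeff w r * (w == w0)%:R)); last first.
  by congr (_ * _); apply: (congr1 (ratfun_eval_rmorph y_tr)); rewrite -coeffU.
rewrite (rmorphM (ratfun_eval_rmorph y_tr)) rmorph_nat mulrCA -natrM mulnb.
congr (_ * (nat_of_bool _)%:R); apply/eqP/andP => [vE|[/forallP off /eqP wE]].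
  split.
    apply/forallP => k; apply/implyP => /andP[ki kj].
    by rewrite -vE /set_idx mnmE (negPf ki) (negPf kj).
  by rewrite /w0 -vE /set_idx !mnmE !eqxx (eq_sym j i) (negPf ij) -pair_idxE.
apply/mnmP => k; rewrite /set_idx mnmE wE /w0 pair_idx0 pair_idx1.
case: (eqVneq k i) => [->|ki] //; case: (eqVneq k j) => [->|kj] //.
by have := off k; rewrite ki kj => /eqP.
Qed.

End RAction.

(** * Flatness *)

Lemma coeff_tens_map (B C : nzRingType) n (phi : {additive B -> C}) (v : tens B n) u :
  coeff u (tens_map phi v) = phi (coeff u v).
Proof.
rewrite -{2}(freeg_sumE v) /tens_map !raddf_sum /=; apply: eq_bigr => m _.
rewrite !coeffU; case: eqP => _; by rewrite ?mulr1 // !mulr0 raddf0.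
Qed.

Section SolutionCoordinates.
Variables (K : fieldType) (p : nat).
Hypothesis hp : p \in [pchar K].
Variables (n r' : nat) (Lam : 'I_n -> 'F_p) (a : 'F_p).
Hypothesis ha : a != 0.
Local Notation r := r'.+1.
Local Notation A := {mpoly K[n]}.
Local Notation L := {fraction {mpoly K[n]}}.
Local Notation aL := (of_Fp L a).
Variable (k : 'X_{1..r}).

Lemma pL0 : p%:R = 0 :> L.
Proof. by rewrite -(rmorph_nat (@cst K n)) (pcharf0 hp) rmorph0. Qed.

Section Coordinates.
Variables (W : 'X_{1..n} -> {mpoly int[r + n + n]}).
Hypothesis hW : is_weight W.
Variable (Q : 'X_{1..r} -> tens A n).
Hypothesis hQ : is_expansion a Lam W Q.

Lemma coeff_weight_master (u : 'X_{1..n}) :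
  coeff u (weight_master K a Lam W) =
  if mdeg u == r then
    int_eval (fun j : 'I_r => 'X_j) (fun i => ('X_i : A)%:MP)
      (fun i => of_Fp _ (Lam i)) (W u) *
    master a Lam (fun j : 'I_r => 'X_j : {mpoly A[r]}) (fun i => ('X_i : A)%:MP)
  else 0.
Proof.
rewrite /weight_master raddf_sum /=; case: eqP => [ur|ur]; last first.
  rewrite big1 // => u' /eqP u'r; rewrite coeffU; case: eqP => [E1|_].
    by rewrite -E1 in ur.
  by rewrite mulr0.
have ltu : (mdeg u < r.+1)%N by rewrite ur.
rewrite (bigD1 (BMultinom ltu)) /= ?ur // coeffU eqxx mulr1 big1 ?addr0 // => u'.
move=> /andP[_ u'u]; rewrite coeffU; case: eqP => [E1|_]; last by rewrite mulr0.
by case/eqP: u'u; apply/val_inj.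
Qed.

Lemma sum_ncol (c : 'I_r -> 'I_n) : (\sum_i ncol c i = r)%N.
Proof.
under eq_bigr => i _ do rewrite ncol_sum.
rewrite exchange_big /= -[RHS](card_ord r) -sum1_card; apply: eq_bigr => j _.
by rewrite (bigD1 (c j)) //= eqxx big1 // => i; rewrite eq_sym => /negPf ->.
Qed.

(** Substituting [z] for x acts on the coefficients only and fixes the [h_k(s_j)]. Applying [newton]
    to the evaluated expansion therefore leaves the single term of index [k]. *)
Lemma tens_eval_solution (z : 'I_n -> L) :
  tens_eval (Q k) z = solution a Lam k (@ord_lt n) z.
Proof.
apply/eqP/freeg_eqP => u.
pose ez : {rmorphism A -> L} := GRing.RMorphism.clone _ _ (mmap (@cst K n) z) _.
rewrite [LHS](coeff_tens_map ez).
pose ev : {rmorphism {mpoly A[r]} -> {mpoly L[r]}} :=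
  GRing.RMorphism.clone _ _ (map_mpoly ez) _.
have evX j : ev 'X_j = 'X_j by exact: map_mpolyX.
have evC c : ev c%:MP = (ez c)%:MP by exact: map_mpolyC.
have evx i : ev ('X_i : A)%:MP = (z i)%:MP by rewrite evC /ez /= mmapX mmap1U.
case: hQ => D Q0 QE.
have sumE : newton aL k (ev (\sum_(k' : 'X_{1..r < D})
    coeff u ((\prod_(l < r) hpoly a (k' l) ('X_l : {mpoly A[r]})) *:
             tens_map (@mpolyC r A) (Q k')))) = ez (coeff u (Q k)).
  rewrite rmorph_sum raddf_sum.
  transitivity (\sum_(k' : 'X_{1..r < D})
      ez (coeff u (Q k')) * (k' == k :> 'X_{1..r})%:R).
    apply: eq_bigr => k' _ /=; rewrite coeffZ (coeff_tens_map (@mpolyC r A)).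
    rewrite rmorphM /= evC rmorph_prod mulrC mul_mpolyC newtonZ; congr (_ * _).
    rewrite -(newton_hpoly a L k k'); congr newton; apply: eq_bigr => l _.
    by rewrite rmorph_hpoly evX.
  have [leD|ltD] := leqP D (mdeg k).
    rewrite Q0 // coeff0 raddf0 big1 // => k' _.
    case: eqP => [kE|_]; last by rewrite mulr0.
    by have := bmdeg k'; rewrite kE ltnNge leD.
  rewrite (bigD1 (BMultinom ltD)) //= eqxx mulr1 big1 ?addr0 // => k' k'k.
  by case: eqP => [kE|_]; [case/eqP: k'k; apply/val_inj | rewrite mulr0].
have := congr1 (coeff u) QE.
rewrite coeff_weight_master raddf_sum /= => /(congr1 ev)/(congr1 (newton aL k)) expE.
apply: (etrans (esym (etrans expE sumE))); move=> {QE expE sumE}.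
(* Outside total degree [r] both coordinates vanish, because a colouring colours all [r]
   variables. *)
case: eqP => [ur|ur]; last first.
  rewrite coeff_solution !rmorph0 raddf0 big_pred0 ?mul0r ?raddf0 // => c.
  apply/negP => /forallP cu; apply: ur; rewrite mdegE -[RHS](sum_ncol c).
  by apply: eq_bigr => i _; rewrite (eqP (cu i)).
rewrite (coeff_solution_weight _ _ _ _ hW ur) rmorphM rmorph_master.
apply: (congr1 (newton aL k)); apply: (congr2 *%R).
  rewrite /int_eval /mmap rmorph_sum; apply: eq_bigr => m _.
  rewrite rmorphM rmorph_int; apply: (congr2 *%R); first by [].
  rewrite /mmap1 rmorph_prod; apply: eq_bigr => i _; rewrite rmorphXn.
  apply: (congr1 (fun P => P ^+ _)); case: splitP => [i' _|i' _]; last first.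
    by rewrite rmorph_of_Fp (rmorph_of_Fp (@mpolyC r L)).
  case: splitP => [j _|j _]; [exact: evX | exact: evx].
by apply: (congr2 *%R); apply: eq_bigr => i _; apply: eq_bigr => j _ /=;
  rewrite ?evX ?evx.
Qed.

End Coordinates.
End SolutionCoordinates.

Section Flatness.
Variables (K : fieldType) (p : nat).
Hypothesis hp : p \in [pchar K].
Variables (n r' : nat) (Lam : 'I_n -> 'F_p) (a : 'F_p).
Hypothesis ha : a != 0.
Local Notation r := r'.+1.
Local Notation L := {fraction {mpoly K[n]}}.
Local Notation aL := (of_Fp L a).
Variable (k : 'X_{1..r}).
Variable R : 'I_n -> 'I_n ->
  {linear tens {fraction {poly K}} 2 -> tens {fraction {poly K}} 2}.
Hypothesis hR : forall i j, is_Rmatrix (of_Fp K (Lam i)) (of_Fp K (Lam j)) (R i j).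

Lemma R_at_solution (m j : 'I_n) (z : 'I_n -> L) :
  j != m -> transcendental (z m - z j) ->
  R_at R m j (z m - z j) (solution a Lam k (move_lt m j) z) =
  solution a Lam k (move_lt m j.+1) z.
Proof.
move=> jm tr; apply/eqP/freeg_eqP => v; rewrite coeff_solution.
pose phi := ratfun_eval_rmorph tr.
have phiX : phi (FracField.tofrac 'X) = z m - z j.
  by rewrite [LHS](ratfun_eval_poly tr) map_polyX hornerX.
have phiC i : phi (FracField.tofrac (of_Fp K (Lam i))%:P) = of_Fp L (Lam i).
  by rewrite [LHS](ratfun_eval_poly tr) map_polyC hornerC /= (rmorph_of_Fp (@cst K n)).
pose Rc := Rcoef (R m j) phi.
have Rh b c l l' : c%:R * Rc b.+1 c l l' +
    (of_Fp L (Lam m) - b%:R - (z m - z j)) * Rc b c.+1 l l' =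
    (0 < l)%:R * (of_Fp L (Lam j) - l'%:R) * Rc b c l.-1 l' +
    (0 < l')%:R * (l%:R - (z m - z j)) * Rc b c l l'.-1.
  by have := Rcoef_fh (hR m j) phi b c l l'; rewrite !phiC phiX.
have ex := @exchange_poly n m L r z (fun i => of_Fp L (Lam i)) j Rc v jm
  (Rcoef00 (hR m j) phi) (Rcoef_f (hR m j) phi) Rh.
rewrite /= in ex; rewrite -[\sum_(c | _) _]ex.
rewrite mulr_suml [RHS]raddf_sum /solution /R_at fglift_sum [LHS]raddf_sum /=.
apply: eq_bigr => c _; rewrite -scalerAl newtonZ.
rewrite [LHS](coeff_R_at R tr); last by rewrite eq_sym.
have uE i : colour_mnm c i = ncol c i by rewrite mnmE.
have -> : agree_off m j (colour_mnm c) v = agree_off m j (ncol c) v.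
  by apply: eq_forallb => i; rewrite uE.
by rewrite [LHS]mulrC !uE.
Qed.

Lemma R_at_chain (m : 'I_n) (z : 'I_n -> L) (s : seq 'I_n) t :
  map val s = iota t (size s) -> m \notin s ->
  (forall j, j != m -> transcendental (z m - z j)) ->
  foldl (fun u j => R_at R m j (z m - z j) u) (solution a Lam k (move_lt m t) z) s =
  solution a Lam k (move_lt m (t + size s)) z.
Proof.
move=> + + tr; elim: s t => [|j s IH] t /=; first by rewrite addn0.
rewrite inE negb_or => -[jt sE] /andP[mj ms].
have jm : j != m by rewrite eq_sym.
subst t; rewrite R_at_solution //; last exact: tr.
by rewrite -addSnnS; apply: (IH _ sE ms).
Qed.

Hypothesis k_last : forall j, (k j).+1%:R = 0 :> L.

Lemma map_val_gt (m : 'I_n) :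
  map val [seq j : 'I_n <- enum 'I_n | (m < j)%N] = iota m.+1 (n - m.+1).
Proof.
rewrite -(filter_map val (fun j => m < j)%N) val_enum_ord.
have -> : iota 0 n = iota 0 (m.+1 + (n - m.+1)) by rewrite subnKC.
rewrite iotaD add0n filter_cat.
rewrite (eq_in_filter (a2 := pred0)) ?filter_pred0 ?cat0s => [|j].
  by apply/all_filterP/allP => j; rewrite mem_iota => /andP[].
by rewrite mem_iota add0n ltnS /= => jm; rewrite ltnNge jm.
Qed.

Lemma map_val_lt (m : 'I_n) :
  map val [seq j : 'I_n <- enum 'I_n | (j < m)%N] = iota 0 m.
Proof.
rewrite -(filter_map val (fun j => j < m)%N) val_enum_ord.
exact: (@filter_iota_ltn 0 n m (ltnW (ltn_ord m))).
Qed.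

(** The term [+ a] in the factors with [j < m] makes their arguments the differences [z' m - z' j]
    at the shifted point. The cyclic step thus falls between the two groups of factors, and each
    group is a chain of exchanges at one point. *)
Lemma qKZ_solution (m : 'I_n) (z : 'I_n -> L) :
  (forall j, j != m -> transcendental (z m - z j)) ->
  (forall j, j != m -> transcendental (z m + aL - z j)) ->
  qKZ R aL m z (solution a Lam k (@ord_lt n) z) =
  solution a Lam k (@ord_lt n) (shift_pt m aL z).
Proof.
move=> tr tr_a; have pr_p := pcharf_prime hp.
rewrite /qKZ foldl_cat.
set s1 := [seq j <- _ | (m < _)%N]; set s2 := [seq j <- _ | (_ < m)%N].
set z' := shift_pt m aL z.
have -> u0 : foldl (fun u j =>
      R_at R m j (z m - z j + (if (j < m)%N then aL else 0)) u) u0 s1 =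
    foldl (fun u j => R_at R m j (z m - z j) u) u0 s1.
  have : all (fun j : 'I_n => m < j)%N s1 by apply: filter_all.
  elim: s1 u0 => //= j s IH u0 /andP[mj sm].
  by rewrite IH // ltnNge ltnW // addr0.
have -> u0 : foldl (fun u j =>
      R_at R m j (z m - z j + (if (j < m)%N then aL else 0)) u) u0 s2 =
    foldl (fun u j => R_at R m j (z' m - z' j) u) u0 s2.
  have : all (fun j : 'I_n => j < m)%N s2 by apply: filter_all.
  elim: s2 u0 => //= j s IH u0 /andP[jm sm].
  rewrite IH // jm /z' /shift_pt eqxx.
  have /negPf -> : j != m by apply: contraTneq jm => ->; rewrite ltnn.
  by rewrite addrAC.
have s1E : map val s1 = iota m.+1 (size s1).
  by have := map_val_gt m; rewrite -/s1 => E1; rewrite -(size_map val s1) E1 size_iota.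
have s2E : map val s2 = iota 0 (size s2).
  by have := map_val_lt m; rewrite -/s2 => E1; rewrite -(size_map val s2) E1 size_iota.
have size1 : size s1 = (n - m.+1)%N.
  by rewrite -(size_map val) map_val_gt size_iota.
have size2 : size s2 = m by rewrite -(size_map val) map_val_lt size_iota.
have -> : solution a Lam k (@ord_lt n) z = solution a Lam k (move_lt m m.+1) z.
  by apply: eq_solution => // i j; rewrite move_ltS move_lt_ord.
rewrite R_at_chain //; last by rewrite mem_filter ltnn.
have cyc : solution a Lam k (move_lt m n) z = solution a Lam k (move_lt m 0) z'.
  exact: (solution_cyclic Lam pr_p (pL0 hp n) ha k_last m z).
rewrite size1 (subnKC (ltn_ord m)) cyc.
have tr' j : j != m -> transcendental (z' m - z' j).
  by move=> jm; rewrite /z' /shift_pt eqxx (negPf jm); exact: tr_a.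
have ms2 : m \notin s2 by rewrite mem_filter ltnn.
apply: (etrans (R_at_chain s2E ms2 tr')).
have size2' : (0 + size s2 = m)%N by rewrite add0n.
apply: eq_solution; last by [].
by move=> i j; rewrite size2'; apply: move_lt_ord.
Qed.

End Flatness.

Theorem theorem7p2 (K : fieldType) (p : nat) (hp : p \in [pchar K])
    (hp2 : (2 < p)%N) (n r : nat) (hn : (1 <= n)%N) (hr : (1 <= r)%N)
    (Lam : 'I_n -> 'F_p) (a : 'F_p) (ha : a != 0)
    (R : 'I_n -> 'I_n ->
       {linear tens {fraction {poly K}} 2 -> tens {fraction {poly K}} 2})
    (hR : forall i j : 'I_n,
       is_Rmatrix (of_Fp K (Lam i)) (of_Fp K (Lam j)) (R i j))
    (W : 'X_{1..n} -> {mpoly int[r + n + n]}) (hW : is_weight W)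
    (Q : 'X_{1..r} -> tens {mpoly K[n]} n) (hQ : is_expansion a Lam W Q)
    (l : 'I_r -> nat) :
  let L := {fraction {mpoly K[n]}} in
  let x := @gen_pt K n in
  let aL := of_Fp L a in
  let Ql := tens_eval (Q [multinom (p * l j + p.-1)%N | j < r]) in
  [/\ forall m : 'I_n, Ql (shift_pt m aL x) = qKZ R aL m x (Ql x),
      forall m : 'I_n, pcurv R p aL m x (Ql x) = Ql x
    & e_diag (fun i => of_Fp L (Lam i)) (Ql x) = 0].
Proof.
case: r hr W hW Q hQ l => // r' _ W hW Q hQ l L x aL Ql.
set k := [multinom _ | j < _] in Ql *.
have pr_p := pcharf_prime hp.
have p0 : p%:R = 0 :> L := pL0 hp n.
(* The successor of [p l_j + p - 1] is a multiple of p. *)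
have k_last j : (k j).+1%:R = 0 :> L.
  by rewrite mnmE -addnS (prednK (prime_gt0 pr_p)) natrD natrM p0 mul0r addr0.
have QE z : Ql z = solution a Lam k (@ord_lt n) z.
  exact: (tens_eval_solution k hW hQ z).
have aE (b : K) (c : nat) : c%:R * aL + cst n b = cst n (c%:R * of_Fp K a + b).
  by rewrite rmorphD rmorphM rmorph_nat (rmorph_of_Fp (@cst K n)).
(* Flatness is needed at every point met by [pcurv]. The differences there are [x m - x j] plus a
   constant, hence still transcendental. *)
have flat m c : qKZ R aL m (shift_pt m (c%:R * aL) x) (Ql (shift_pt m (c%:R * aL) x)) =
    Ql (shift_pt m (c.+1%:R * aL) x).
  rewrite !QE (qKZ_solution hp ha hR k_last).
  - apply: eq_solution => // i; rewrite /shift_pt.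
    by case: (i == m); rewrite // -natr1 mulrDl mul1r addrA.
  - move=> j jm; rewrite /shift_pt eqxx (negPf jm) addrAC.
    have := aE 0 c; rewrite rmorph0 addr0 => ->; exact: transcendental_diff.
  move=> j jm; rewrite /shift_pt eqxx (negPf jm).
  have -> : x m + c%:R * aL + aL - x j = x m - x j + c.+1%:R * aL.
    by rewrite addrAC [x m + _ - x j]addrAC -natr1 mulrDl mul1r addrA.
  have := aE 0 c.+1; rewrite rmorph0 addr0 => ->; exact: transcendental_diff.
have shift0 m : Ql (shift_pt m (0%:R * aL) x) = Ql x.
  by rewrite !QE; apply: eq_solution => // i; rewrite /shift_pt mul0r addr0 if_same.
split=> [m|m|]; last by rewrite QE; apply: solution_singular.
  rewrite !QE (qKZ_solution hp ha hR k_last) // => j jm.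
    have : transcendental (x m - x j + cst n 0) := transcendental_diff 0 jm.
    by rewrite (rmorph0 (@cst K n)) addr0.
  have : transcendental (x m - x j + cst n (of_Fp K a)) := transcendental_diff _ jm.
  by rewrite (rmorph_of_Fp (@cst K n)) addrAC.
(* Each factor of the p-curvature operator advances the point by [a]; after p of them it has
   returned to [x]. *)
have pcurvS d :
    foldl (fun u c => qKZ R aL m (shift_pt m (c%:R * aL) x) u) (Ql x) (iota 0 d) =
    Ql (shift_pt m (d%:R * aL) x).
  elim: d => [|d IH]; first by rewrite shift0.
  by rewrite -addn1 iotaD foldl_cat IH /= add0n flat addn1.
by rewrite /pcurv pcurvS p0 -[X in _ = X](shift0 m).
Qed.
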